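(* Let $\mathcal W$ be a Banach space with a Schauder basis $(e_n)$. Then either $\mathcal W$ has a minimal subspace, or there is a block subspace $\mathcal X=[x_n]\subseteq\mathcal W$ (with $(x_n)$ a block basis of $(e_n)$) which, with respect to its basis $(x_n)$, is $\alpha$-minimal and $\omega\alpha$-tight for some countable ordinal $\alpha$.
   Context: A minimal subspace is an infinite-dimensional closed subspace $\mathcal V$ that isomorphically embeds into every infinite-dimensional closed subspace of $\mathcal V$. $\omega\alpha$ denotes ordinal multiplication. For sequences $(x_i)_{i\le k},(y_i)_{i\le k}$ and $K\ge1$, $(x_i)\sim_K(y_i)$ means $\frac1K\|\sum_i a_ix_i\|\le\|\sum_i a_iy_i\|\le K\|\sum_i a_ix_i\|$ for all real $a_i$. For a basic sequence $(y_n)$ and a Banach space $\mathcal Y$, $T((y_n),\mathcal Y,K)$ is the tree of all finite sequences $(v_0,\dots,v_k)$ in $\mathcal Y$, including the empty one, with $(v_0,\dots,v_k)\sim_K(y_0,\dots,y_k)$. For a well-founded tree $T$, $\rho_T(s)=\sup\{\rho_T(t)+1:s\prec t\in T\}$ ($0$ at terminal nodes) and ${\rm rank}(T)=\sup\{\rho_T(s)+1:s\in T\}$; for ill-founded $T$, ${\rm rank}(T)=\infty>\alpha$ for all ordinals $\alpha$. ${\rm Emb}((y_n),\mathcal Y)=\sup_{K\ge1}{\rm rank}(T((y_n),\mathcal Y,K))$. A space $\mathcal X$ with Schauder basis $(x_n)$ is $\beta$-minimal if for every block basis $(z_n)$ of $(x_n)$ and every infinite-dimensional closed subspace $\mathcal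 Y\subseteq\mathcal X$, ${\rm Emb}((z_n),\mathcal Y)\ge\beta$. It is $\beta$-tight if for every block basis $(y_n)$ of $(x_n)$ there are finite intervals $I_0<I_1<\dots$ of $\mathbb N$ such that for every infinite $A\subseteq\mathbb N$, ${\rm Emb}\big((y_n),[x_n:n\notin\bigcup_{j\in A}I_j]\big)\le\beta$ ($[\cdot]$ = closed linear span). *)

(* Defs.v *)
From HB Require Import structures.
From mathcomp Require Import all_boot all_order all_algebra.
From mathcomp Require Import all_classical all_reals all_analysis.
Set Implicit Arguments. Unset Strict Implicit. Unset Printing Implicit Defensive.
Import Order.TTheory GRing.Theory Num.Theory.
Import numFieldNormedType.Exports.
Local Open Scope classical_set_scope.
Local Open Scope ring_scope.

(* A strict well-order on O; an ordinal is the order type of such an order. *)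
Definition well_order (O : Type) (lt : O -> O -> Prop) : Prop :=
  well_founded lt /\
  (forall a b c, lt a b -> lt b c -> lt a c) /\
  (forall a b, lt a b \/ a = b \/ lt b a).

Definition countable_type (O : Type) : Prop :=
  exists f : O -> nat, injective f.

(* ordinal product  omega * alpha : alpha copies of omega, i.e. the
   lexicographic order on alpha x omega with the alpha-coordinate major. *)
Definition omega_times (O : Type) (lt : O -> O -> Prop) : O * nat -> O * nat -> Prop :=
  fun p q => lt p.1 q.1 \/ (p.1 = q.1 /\ (p.2 < q.2)%N).

Definition strict_prefix (X : Type) (s t : seq X) : Prop :=
  (size s < size t)%N /\ s = take (size s) t.

(* rank(T) <= type of the well-order (O,lt) restricted to P:
   there is a map from the nodes of T into P that strictly decreases
   along proper extensions (this is false for ill-founded T). *)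
Definition rank_le (X : Type) (T : set (seq X)) (O : Type)
  (lt : O -> O -> Prop) (P : O -> Prop) : Prop :=
  exists f : seq X -> O, (forall s, T s -> P (f s)) /\
    (forall s t, T s -> T t -> strict_prefix s t -> lt (f t) (f s)).

Section Banach.
Context {R : realType} {W : normedModType R}.

Definition schauder_basis (e : nat -> W) : Prop :=
  forall x : W, exists! a : nat -> R,
    (fun N : nat => \sum_(i < N) a i *: e i) @ \oo --> x.

Definition lin_comb (x : nat -> W) (S : set nat) : set W :=
  [set v | exists (N : nat) (a : nat -> R),
     (forall i, ~ S i -> a i = 0) /\ v = \sum_(i < N) a i *: x i].

Definition cspan (x : nat -> W) (S : set nat) : set W := closure (lin_comb x S).

Definition block_basis (x e : nat -> W) : Prop :=
  exists (p : nat -> nat) (c : nat -> R),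
    (forall n, (p n < p n.+1)%N) /\
    (forall n, x n != 0 /\ x n = \sum_(p n <= i < p n.+1) c i *: e i).

Definition lin_subspace (Y : set W) : Prop :=
  Y 0 /\ (forall u v, Y u -> Y v -> Y (u + v)) /\
  (forall (a : R) u, Y u -> Y (a *: u)).

Definition lin_indep (n : nat) (v : 'I_n -> W) : Prop :=
  forall a : 'I_n -> R, \sum_(i < n) a i *: v i = 0 -> forall i, a i = 0.

Definition inf_dim (Y : set W) : Prop :=
  forall n : nat, exists v : 'I_n -> W, (forall i, Y (v i)) /\ lin_indep v.

Definition idc_subspace (V Y : set W) : Prop :=
  Y `<=` V /\ lin_subspace Y /\ closed Y /\ inf_dim Y.

Definition iso_embeds (V Y : set W) : Prop :=
  exists (T : W -> W) (c C : R), 0 < c /\ 0 < C /\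
    (forall u, V u -> Y (T u)) /\
    (forall (a : R) u v, V u -> V v -> T (a *: u + v) = a *: T u + T v) /\
    (forall u, V u -> c * `|u| <= `|T u| <= C * `|u|).

Definition minimal_subspace (V : set W) : Prop :=
  idc_subspace setT V /\ forall Y, idc_subspace V Y -> iso_embeds V Y.

Definition seq_equiv (K : R) (s : seq W) (y : nat -> W) : Prop :=
  forall a : nat -> R,
    K^-1 * `|\sum_(i < size s) a i *: nth 0 s i|
      <= `|\sum_(i < size s) a i *: y i|
      <= K * `|\sum_(i < size s) a i *: nth 0 s i|.

Definition emb_tree (y : nat -> W) (Y : set W) (K : R) : set (seq W) :=
  [set s | (forall i, (i < size s)%N -> Y (nth 0 s i)) /\ seq_equiv K s y].

(* Emb((y_n), Y) >= beta, beta the type of (O,lt):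
   for every gamma < beta (gamma = type of the initial segment below o)
   some tree has rank > gamma. *)
Definition emb_ge (y : nat -> W) (Y : set W) (O : Type) (lt : O -> O -> Prop) : Prop :=
  forall o : O, exists K : R, 1 <= K /\
    ~ rank_le (emb_tree y Y K) lt (fun o' => lt o' o).

Definition emb_le (y : nat -> W) (Y : set W) (O : Type) (lt : O -> O -> Prop) : Prop :=
  forall K : R, 1 <= K -> rank_le (emb_tree y Y K) lt (fun _ => True).

Definition beta_minimal (x : nat -> W) (O : Type) (lt : O -> O -> Prop) : Prop :=
  forall z, block_basis z x ->
  forall Y, idc_subspace (cspan x setT) Y -> emb_ge z Y lt.

Definition beta_tight (x : nat -> W) (O : Type) (lt : O -> O -> Prop) : Prop :=
  forall y, block_basis y x ->
  exists a b : nat -> nat,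
    (forall j, (a j <= b j)%N) /\ (forall j, (b j < a j.+1)%N) /\
    forall A : set nat, (forall n, exists m, (n <= m)%N /\ A m) ->
      emb_le y (cspan x [set n | ~ exists j, A j /\ (a j <= n <= b j)%N]) lt.

End Banach.

(* Main.v *)
(**
Coordinates are restricted to the rationals, so that positions of the games below are
countable in number. In the asymptotic game of length omega * alpha, player I plays
integers n_i together with a strictly decreasing sequence of ordinals, and player II plays
finite sets of vectors beyond n_i and vectors w_i in the span of everything played, trying
to keep (w_i) K-equivalent to a given block sequence (y_i).

If for every countable alpha and every block subspace Z, player II wins this game in Z for
some block sequence y, then a Kunen-Martin argument, in which y is built along a branch
together with the strategy, produces a y for which II wins the infinite game. Otherwise
take the least alpha for which this fails, say in Z. Failure in Z means that I wins all the
games of length omega * alpha; interval bounds for the answers of I to all finite positions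
give omega * alpha-tightness of Z and of its block subspaces, the clock of I being the rank
function on the trees of embeddings.

Where II does win for some y in every Z, the omega spare rounds between two ordinals allow
II to embed arbitrary finite sets of vectors of [y]. Stabilizing the countable sets of
winning positions with respect to block subspaces yields a single y all of whose block
sequences embed with rank alpha into every block subspace. For the infinite game this gives
a minimal subspace. For all ordinals below the least failing alpha, diagonalizing over
countably many such y gives alpha-minimality.
*)
Require Import Defs.
From HB Require Import structures.
From mathcomp Require Import all_boot all_order all_algebra.
From mathcomp Require Import all_classical all_reals all_analysis.
From mathcomp Require Import zify ring lra.
Import numFieldNormedType.Exports.
Set Implicit Arguments.
Unset Strict Implicit.
Unset Printing Implicit Defensive.
Import Order.TTheory GRing.Theory Num.Theory.
Local Open Scope classical_set_scope.
Local Open Scope ring_scope.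

(* Vectors with finitely many rational coordinates with respect to a sequence are coded
   by polynomials, so that finite positions in games form a countable set. *)
Local Notation V := {poly rat}.

(** The gap between alpha and omega alpha comes from one clock read in two ways: the pairs below
    [(al, 0)] in the lexicographic order form omega times alpha. When I wins, its answers use the
    whole pair, and ranks are bounded by omega alpha. When II wins, the second coordinate is spent
    on extra rounds, and only the first one survives as a rank. Coding costs only constants: a block
    basis or a subspace is replaced by rational blocks up to a factor 2, and [Emb] is a supremum
    over all constants. Inclusion of block sequences is taken up to finitely many terms, as
    diagonalization demands; missing initial terms are restored later at the price of a larger
    constant. The obstacle in tightness is that the bounds given by I say nothing about vectors
    lying before the first removed interval. So II must also fail when given an arbitrary finite
    list of vectors in advance. To see this, the span of the list is moved far out, with a constant
    that does not depend on the distance. *)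

(** * Substitution in coded vectors *)

Definition sub (s : nat -> V) (p : V) : V := \sum_(i < size p) p`_i *: s i.

Lemma sub_wide (s : nat -> V) (p : V) n :
  (size p <= n)%N -> sub s p = \sum_(i < n) p`_i *: s i.
Proof.
move=> le_pn; rewrite /sub (big_ord_widen_cond n xpredT (fun i => p`_i *: s i)) //=.
rewrite big_mkcond /=; apply: eq_bigr => i _; case: ltnP => // h.
by rewrite nth_default // scale0r.
Qed.

Lemma sub0 s : sub s 0 = 0.
Proof. by rewrite /sub size_poly0 big_ord0. Qed.

Lemma subD s (p q : V) : sub s (p + q) = sub s p + sub s q.
Proof.
pose n := maxn (size p) (size q).
rewrite !(@sub_wide s _ n) ?leq_maxl ?leq_maxr ?size_polyD //.
by rewrite -big_split /=; apply: eq_bigr => i _; rewrite coefD scalerDl.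
Qed.

Lemma subZ s a (p : V) : sub s (a *: p) = a *: sub s p.
Proof.
rewrite (@sub_wide s _ (size p)) ?size_scale_leq // scaler_sumr.
by apply: eq_bigr => i _; rewrite coefZ scalerA.
Qed.

Lemma sub_sum s I (r : seq I) (P : pred I) (F : I -> V) :
  sub s (\sum_(i <- r | P i) F i) = \sum_(i <- r | P i) sub s (F i).
Proof. by elim/big_rec2: _ => [|i y1 y2 _ <-]; rewrite ?sub0 ?subD. Qed.

Lemma subXn s i : sub s 'X^i = s i.
Proof.
rewrite (@sub_wide s _ i.+1) ?size_polyXn // big_ord_recr /= coefXn eqxx scale1r.
rewrite big1 ?add0r // => j _; rewrite coefXn.
by rewrite (ltn_eqF (ltn_ord j)) scale0r.
Qed.

Lemma sub_X p : sub (fun i => 'X^i) p = p.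
Proof.
apply/polyP => j; rewrite /sub coef_sum.
under eq_bigr => i _ do rewrite coefZ coefXn.
case: (ltnP j (size p)) => h.
  rewrite (bigD1 (Ordinal h)) //= eqxx mulr1 big1 ?addr0 // => i ne.
  rewrite (_ : (j == i) = false) ?mulr0 //; apply/eqP => e.
  by move/eqP: ne; apply; apply: val_inj.
rewrite nth_default // big1 // => i _.
by rewrite gtn_eqF ?mulr0 // (leq_trans (ltn_ord i) h).
Qed.

Lemma sub_sub (s t : nat -> V) (p : V) : sub s (sub t p) = sub (fun i => sub s (t i)) p.
Proof. by rewrite {2}/sub sub_sum; apply: eq_bigr => i _; rewrite subZ. Qed.

Lemma eq_sub (s t : nat -> V) (p : V) : (forall i, (i < size p)%N -> s i = t i) -> sub s p = sub t p.
Proof. by move=> h; apply: eq_bigr => i _; rewrite h. Qed.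

(** * Finite combinations and their equivalence *)

Section Norm.
Variables (R : realType) (W : normedModType R).
Implicit Types (s t : nat -> W) (c : nat -> R) (p : V).

Definition comb n c s : W := \sum_(i < n) c i *: s i.

Lemma comb_wide n N c s : (n <= N)%N ->
  comb n c s = comb N (fun i => if (i < n)%N then c i else 0) s.
Proof.
move=> le_nN; rewrite /comb (big_ord_widen_cond N xpredT (fun i => c i *: s i)) //=.
rewrite big_mkcond /=; apply: eq_bigr => i _.
by case: ltnP => //; rewrite scale0r.
Qed.

Lemma eq_comb n c c' s s' : (forall i, (i < n)%N -> c i = c' i /\ s i = s' i) ->
  comb n c s = comb n c' s'.
Proof. by move=> h; apply: eq_bigr => i _; have [-> ->] := h i (ltn_ord i). Qed.

Lemma comb_cat m n c s :
  comb (m + n) c s = comb m c s + comb n (fun i => c (m + i)%N) (fun i => s (m + i)%N).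
Proof. by rewrite /comb big_split_ord. Qed.

Lemma combD n c c' s : comb n (fun i => c i + c' i) s = comb n c s + comb n c' s.
Proof. by rewrite /comb -big_split; apply: eq_bigr => i _; rewrite scalerDl. Qed.

Lemma combZ n a c s : comb n (fun i => a * c i) s = a *: comb n c s.
Proof. by rewrite /comb scaler_sumr; apply: eq_bigr => i _; rewrite scalerA. Qed.

Lemma combB n c s t : comb n c (fun i => s i - t i) = comb n c s - comb n c t.
Proof.
by rewrite /comb -sumrB; apply: eq_bigr => i _; rewrite scalerBr.
Qed.

Definition eqv (K : R) n s t := forall c,
  `|comb n c s| <= K * `|comb n c t| /\ `|comb n c t| <= K * `|comb n c s|.

Lemma eqv_sym K n s t : eqv K n s t -> eqv K n t s.
Proof. by move=> h c; have [] := h c. Qed.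

Lemma eqv_trans K K' n s t u : 0 <= K -> 0 <= K' ->
  eqv K n s t -> eqv K' n t u -> eqv (K * K') n s u.
Proof.
move=> K0 K'0 h h' c; have [h1 h2] := h c; have [h3 h4] := h' c; split.
  by rewrite (le_trans h1) // -mulrA ler_wpM2l.
by rewrite (le_trans h4) // (mulrC K) -mulrA ler_wpM2l.
Qed.

Lemma eqv_mono K K' n s t : K <= K' -> eqv K n s t -> eqv K' n s t.
Proof.
move=> le_K h c; have [h1 h2] := h c.
by split; [apply: (le_trans h1)|apply: (le_trans h2)]; rewrite ler_wpM2r.
Qed.

Lemma eqv_widen K n m s t : (m <= n)%N -> eqv K n s t -> eqv K m s t.
Proof. by move=> le_mn h c; rewrite !(comb_wide _ _ le_mn); exact: h. Qed.

Lemma eq_eqv K n s t s' t' : (forall i, (i < n)%N -> s i = s' i /\ t i = t' i) ->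
  eqv K n s t -> eqv K n s' t'.
Proof.
move=> e h c; have := h c.
rewrite (@eq_comb n c c s s'); last by move=> i /e [].
by rewrite (@eq_comb n c c t t') // => i /e [].
Qed.

Lemma eqv_refl n s : eqv 1 n s s.
Proof. by move=> c; rewrite !mul1r. Qed.

Lemma eqv0 K s t : eqv K 0 s t.
Proof. by move=> c; rewrite /comb !big_ord0 normr0 mulr0. Qed.

Definition ev s p : W := \sum_(i < size p) ratr p`_i *: s i.

Lemma ev_wide s p n : (size p <= n)%N -> ev s p = comb n (fun i => ratr p`_i) s.
Proof.
move=> le_pn; rewrite /ev -/(comb _ (fun i => ratr p`_i) s) (comb_wide _ _ le_pn).
apply: eq_comb => i _; split=> //; case: ltnP => // h.
by rewrite nth_default // rmorph0.
Qed.

Lemma ev0 s : ev s 0 = 0.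
Proof. by rewrite /ev size_poly0 big_ord0. Qed.

Lemma evD s p q : ev s (p + q) = ev s p + ev s q.
Proof.
pose n := maxn (size p) (size q).
rewrite !(@ev_wide s _ n) ?leq_maxl ?leq_maxr ?size_polyD // -combD.
by apply: eq_comb => i _; rewrite coefD rmorphD.
Qed.

Lemma evZ s a p : ev s (a *: p) = ratr a *: ev s p.
Proof.
rewrite !(@ev_wide s _ (size p)) ?size_scale_leq // -combZ.
by apply: eq_comb => i _; rewrite coefZ rmorphM.
Qed.

Lemma ev_sum s I (r : seq I) (P : pred I) (F : I -> V) :
  ev s (\sum_(i <- r | P i) F i) = \sum_(i <- r | P i) ev s (F i).
Proof. by elim/big_rec2: _ => [|i y1 y2 _ <-]; rewrite ?ev0 ?evD. Qed.

Lemma evXn s i : ev s 'X^i = s i.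
Proof.
rewrite (@ev_wide s _ i.+1) ?size_polyXn // /comb big_ord_recr /= coefXn eqxx rmorph1 scale1r.
rewrite big1 ?add0r // => j _; rewrite coefXn.
by rewrite (ltn_eqF (ltn_ord j)) rmorph0 scale0r.
Qed.

Lemma ev_sub s (t : nat -> V) p : ev s (sub t p) = ev (fun i => ev s (t i)) p.
Proof. by rewrite /sub ev_sum; apply: eq_bigr => i _; rewrite evZ. Qed.

Lemma comb_ev k n c s (r : nat -> V) : (forall i, (i < k)%N -> (size (r i) <= n)%N) ->
  comb k c (fun i => ev s (r i)) = comb n (fun j => \sum_(i < k) c i * ratr (r i)`_j) s.
Proof.
move=> h; rewrite /comb.
under eq_bigr => i _ do rewrite (ev_wide s (h _ (ltn_ord i))) /comb scaler_sumr.
rewrite exchange_big /=; apply: eq_bigr => j _.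
by rewrite scaler_suml; apply: eq_bigr => i _; rewrite scalerA.
Qed.

(** A real combination of the vectors [ev s (r i)] is a combination of [s] whose coefficients depend
    on [r] alone, hence are the same for [t]. *)
Lemma eqv_ev K n k s t (r : nat -> V) : (forall i, (i < k)%N -> (size (r i) <= n)%N) ->
  eqv K n s t -> eqv K k (fun i => ev s (r i)) (fun i => ev t (r i)).
Proof. by move=> h e c; rewrite !(comb_ev _ _ h). Qed.

Lemma comb_sumr n k (a : nat -> R) (C : nat -> nat -> R) s :
  comb n a (fun i => comb k (C i) s) = comb k (fun j => \sum_(i < n) a i * C i j) s.
Proof.
rewrite /comb; under eq_bigr do rewrite scaler_sumr.
rewrite exchange_big; apply: eq_bigr => j _ /=.
by rewrite scaler_suml; apply: eq_bigr => i _; rewrite scalerA.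
Qed.

End Norm.

(** * Rational block sequences, fusion and stabilization *)

(* Blocks as polynomials: disjoint consecutive supports amount to z (n+1) having no
   monomial of degree below the size (degree + 1) of z n. *)
Definition bs (z : nat -> V) :=
  forall n, z n != 0 /\ forall i, (i < size (z n))%N -> (z n.+1)`_i = 0.

(** The region left to II once I has played [n]: the rational span of a tail, without closure. *)
Definition sp (z : nat -> V) n : set V :=
  [set v | exists p : V, (forall i, (i < n)%N -> p`_i = 0) /\ v = sub z p].

(* y is, up to finitely many terms, a block sequence of z. *)
Definition les (y z : nat -> V) := forall n, exists m, sp y m `<=` sp z n.

Lemma sp0 z n : sp z n 0.
Proof. by exists 0; split=> [i _|]; rewrite ?coef0 ?sub0. Qed.

Lemma spD z n u v : sp z n u -> sp z n v -> sp z n (u + v).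
Proof.
move=> [p [hp ->]] [q [hq ->]]; exists (p + q); split=> [i h|]; last by rewrite subD.
by rewrite coefD hp // hq // addr0.
Qed.

Lemma spZ z n a u : sp z n u -> sp z n (a *: u).
Proof.
move=> [p [hp ->]]; exists (a *: p); split=> [i h|]; last by rewrite subZ.
by rewrite coefZ hp // mulr0.
Qed.

Lemma sp_sum z n I (r : seq I) (P : pred I) (F : I -> V) :
  (forall i, P i -> sp z n (F i)) -> sp z n (\sum_(i <- r | P i) F i).
Proof. by move=> h; elim/big_ind: _ => [|u v|i /h //]; [exact: sp0|exact: spD]. Qed.

Lemma sp_sub z n (s : nat -> V) (p : V) :
  (forall i, (i < size p)%N -> p`_i != 0 -> sp z n (s i)) -> sp z n (sub s p).
Proof.
move=> h; apply: sp_sum => i _; have [->|ne] := eqVneq p`_i 0.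
  by rewrite scale0r; exact: sp0.
by apply: spZ; exact: h.
Qed.

Lemma sp_mono z n m : (n <= m)%N -> sp z m `<=` sp z n.
Proof. by move=> le_nm v [p [hp ->]]; exists p; split=> // i h; rewrite hp // (leq_trans h). Qed.

Lemma sp_gen z n i : (n <= i)%N -> sp z n (z i).
Proof.
move=> le_ni; exists 'X^i; split=> [j h|]; last by rewrite subXn.
by rewrite coefXn ltn_eqF // (leq_trans h).
Qed.

Lemma sp_min y m z n : (forall i, (m <= i)%N -> sp z n (y i)) -> sp y m `<=` sp z n.
Proof.
move=> h v [p [hp ->]]; apply: sp_sub => i _ ne; apply: h.
by rewrite leqNgt; apply/negP => /hp /eqP; rewrite (negbTE ne).
Qed.

Lemma les_refl z : les z z.
Proof. by move=> n; exists n. Qed.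

Lemma les_trans x y z : les x y -> les y z -> les x z.
Proof.
move=> xy yz n; have [m hm] := yz n; have [k hk] := xy m.
by exists k; apply: (subset_trans hk).
Qed.

Lemma bs_size z : bs z -> forall n, (size (z n) < size (z n.+1))%N.
Proof.
move=> bz n; rewrite ltnNge; apply/negP => le_sz.
have [/negP] := bz n.+1; case; rewrite -size_poly_eq0.
apply/eqP/eqP; rewrite size_poly_eq0; apply/eqP/polyP => i; rewrite coef0.
have [lt_i|le_i] := ltnP i (size (z n)); first by have [_ ->] := bz n.
by rewrite nth_default // (leq_trans le_sz).
Qed.

Lemma bs_size_gt z : bs z -> forall n, (n < size (z n))%N.
Proof.
move=> bz; elim=> [|n IH]; first by rewrite size_poly_gt0; have [] := bz 0%N.
by apply: leq_ltn_trans (bs_size bz n).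
Qed.

Lemma bs_size_mono z : bs z -> forall n m, (n <= m)%N -> (size (z n) <= size (z m))%N.
Proof.
move=> bz n m; elim: m => [|m IH]; first by rewrite leqn0 => /eqP ->.
rewrite leq_eqVlt => /predU1P[->//|/IH h].
by rewrite (leq_trans h) // ltnW // bs_size.
Qed.

Lemma bs_lo z : bs z -> forall n m i, (n < m)%N -> (i < size (z n))%N -> (z m)`_i = 0.
Proof.
move=> bz n [//|m] i; rewrite ltnS => le_nm lt_i.
by have [_ ->//] := bz m; rewrite (leq_trans lt_i) // bs_size_mono.
Qed.

Lemma sp_lo z : bs z -> forall n v i, sp z n.+1 v -> (i < size (z n))%N -> v`_i = 0.
Proof.
move=> bz n v i [p [hp ->]] lt_i; rewrite /sub coef_sum big1 // => j _; rewrite coefZ.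
have [lt_jn|le_nj] := ltnP j n.+1; first by rewrite hp // mul0r.
by rewrite (bs_lo bz le_nj) // mulr0.
Qed.

Lemma sp_lo0 z : bs z -> forall n v i, sp z n v -> (i < n)%N -> v`_i = 0.
Proof.
move=> bz [//|n] v i spv lt_i; apply: (sp_lo bz spv).
by rewrite (leq_trans lt_i) // bs_size_gt.
Qed.

Lemma bs_tail z k : bs z -> bs (fun i => z (k + i)%N).
Proof. by move=> bz n; rewrite addnS; exact: bz. Qed.

Lemma les_tail z k : les (fun i => z (k + i)%N) z.
Proof.
move=> n; exists n; apply: sp_min => i h; apply: sp_gen.
by rewrite (leq_trans h) // leq_addl.
Qed.

Definition hered (D : (nat -> V) -> Prop) :=
  forall y z, bs y -> les y z -> D z -> D y.

Definition dense_below (D : (nat -> V) -> Prop) X :=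
  forall z, bs z -> les z X -> exists y, [/\ bs y, les y z & D y].

(** The [k]-th term is taken from [Z k], so far out that it lies in [sp (Z n) k] for every [n <= k]
    at once. *)
Lemma diagonal (Z : nat -> nat -> V) :
  (forall n, bs (Z n)) -> (forall n, les (Z n.+1) (Z n)) ->
  exists z, bs z /\ forall n, les z (Z n).
Proof.
move=> bZ lZ.
have lZ' n m : (n <= m)%N -> les (Z m) (Z n).
  elim: m => [|m IH]; first by rewrite leqn0 => /eqP->; exact: les_refl.
  rewrite leq_eqVlt => /predU1P[->|/IH]; first exact: les_refl.
  exact: les_trans.
have H k : exists m, forall n, (n <= k)%N -> sp (Z k) m `<=` sp (Z n) k.
  suff /(_ k (leqnn _)) : forall j, (j <= k)%N -> exists m, forall n, (n <= j)%N -> sp (Z k) m `<=` sp (Z n) k.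
    by [].
  elim=> [|j IH] le_jk.
    have [m hm] := lZ' _ _ le_jk k; exists m => n; rewrite leqn0 => /eqP ->//.
  have [m hm] := IH (ltnW le_jk); have [m' hm'] := lZ' _ _ le_jk k.
  exists (maxn m m') => n; rewrite leq_eqVlt => /predU1P[->|/hm h].
    exact: subset_trans (sp_mono (leq_maxr _ _)) hm'.
  exact: subset_trans (sp_mono (leq_maxl _ _)) h.
have [mu hmu] := choice H.
(* Starting beyond the size of the previous term separates the supports. *)
pose z := fix z k := if k is k'.+1 then Z k (maxn (mu k) (size (z k'))) else Z 0%N (mu 0%N).
have spz k : sp (Z k) (mu k) (z k).
  by case: k => [|k] /=; apply: sp_gen; rewrite ?leq_maxl.
exists z; split=> [n|n k].
  split; first by case: n => [|n]; exact: (bZ _ _).1.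
  move=> i lt_i /=; apply: (sp_lo0 (bZ n.+1)) lt_i; apply: sp_gen.
  exact: leq_maxr.
exists (maxn n k); apply: sp_min => i; rewrite geq_max => /andP[le_ni le_ki].
exact: sp_mono le_ki _ (hmu i n le_ni _ (spz i)).
Qed.

Lemma fusion (D : nat -> (nat -> V) -> Prop) X :
  (forall n, hered (D n)) -> (forall n, dense_below (D n) X) -> bs X ->
  exists y, [/\ bs y, les y X & forall n, D n y].
Proof.
move=> hD dD bX.
have H (nz : nat * {z : nat -> V | bs z /\ les z X}) : exists nz' : nat * {z : nat -> V | bs z /\ les z X},
    nz'.1 = nz.1.+1 /\ les (sval nz'.2) (sval nz.2) /\ D nz.1 (sval nz'.2).
  case: nz => n [z [bz lz]] /=; have [y [by_ ly Dy]] := dD n z bz lz.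
  by exists (n.+1, exist _ y (conj by_ (les_trans ly lz))).
have [f hf] := choice H.
pose s n := iter n f (0%N, exist _ X (conj bX (les_refl X))).
have s1 n : (s n).1 = n by elim: n => //= n IH; have [->] := hf (s n); rewrite IH.
have [z [bz lz]] := @diagonal (fun n => sval (s n).2)
  (fun n => (svalP (s n).2).1) (fun n => (hf (s n)).2.1).
exists z; split=> // [|n]; first exact: (lz 0%N).
apply: hD bz (lz n.+1) _; have := (hf (s n)).2.2; by rewrite s1.
Qed.

Lemma fusion_count (T : countType) (D : T -> (nat -> V) -> Prop) X :
  (forall n, hered (D n)) -> (forall n, dense_below (D n) X) -> bs X ->
  exists y, [/\ bs y, les y X & forall n, D n y].
Proof.
move=> hD dD bX.
have [||y [by_ ly Dy]] := @fusion (fun n z => if unpickle n is Some t then D t z else True) X _ _ bX.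
- by move=> n y z by_ ly; case: unpickle => // t; exact: hD.
- move=> n z bz lz; case: unpickle => [t|]; first exact: dD.
  by exists z; split=> //; exact: les_refl.
by exists y; split=> // t; have := Dy (pickle t); rewrite pickleK.
Qed.

(** For a fixed [t], either some further sequence loses [t], and then for good by monotonicity, or
    none ever does. Both alternatives are hereditary, so fusion settles all [t] together. *)
Lemma stabilize (T : countType) (sg : (nat -> V) -> set T) X : bs X ->
  (forall y z, bs y -> les y z -> sg y `<=` sg z) ->
  exists y, [/\ bs y, les y X & forall z, bs z -> les z y -> sg z = sg y].
Proof.
move=> bX mono.
have [||y [by_ ly Dy]] := @fusion_count T
   (fun t z => ~ sg z t \/ forall z', bs z' -> les z' z -> sg z' t) X _ _ bX.
- move=> t y z by_ ly [h|h]; first by left=> /(mono _ _ by_ ly).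
  by right=> z' bz' lz'; apply: h => //; apply: les_trans ly.
- move=> t z bz lz.
  have [h|] := pselect (forall z', bs z' -> les z' z -> sg z' t).
    by exists z; split; [|exact: les_refl|right].
  move=> /existsNP[z' /not_implyP[bz' /not_implyP[lz' nt]]].
  by exists z'; split=> //; left.
exists y; split=> // z bz lz; apply/seteqP; split; first exact: mono.
by move=> t yt; case: (Dy t) => // /(_ z bz lz).
Qed.

Definition span (F : seq V) : set V :=
  [set w | exists p : V, (size p <= size F)%N /\ w = sub (nth 0 F) p].

Lemma sub_catl (F G : seq V) (p : V) : (size p <= size F)%N ->
  sub (nth 0 (F ++ G)) p = sub (nth 0 F) p.
Proof.
by move=> h; apply: eq_sub => i lt_i; rewrite nth_cat (leq_trans lt_i h).
Qed.

Lemma span_catl F G w : span F w -> span (F ++ G) w.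
Proof.
move=> [p [hp ->]]; exists p; rewrite size_cat sub_catl //.
by split=> //; rewrite (leq_trans hp) // leq_addr.
Qed.

Lemma span_sp F z n w : (forall g, g \in F -> sp z n g) -> span F w -> sp z n w.
Proof.
move=> h [p [hp ->]]; apply: sp_sub => i lt_i _; apply: h.
by rewrite mem_nth // (leq_trans lt_i).
Qed.

Lemma span_sub F (u : seq V) (p : V) : (forall w, w \in u -> span F w) ->
  (size p <= size u)%N -> span F (sub (nth 0 u) p).
Proof.
move=> h le_pu; rewrite /sub.
elim/big_rec: _ => [|i v _ [q [hq ->]]]; first by exists 0; rewrite size_poly0 sub0.
have [|r [hr ->]] := h u`_i; first by rewrite mem_nth // (leq_trans (ltn_ord i)).
exists (p`_i *: r + q); rewrite subD subZ; split=> //.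
by rewrite (leq_trans (size_polyD _ _)) // geq_max hq andbT (leq_trans (size_scale_leq _ _)).
Qed.

(** * Games with a clock *)

Section Games.
Variables (R : realType) (W : normedModType R) (e : nat -> W).

Local Notation E s := (fun i : nat => ev e (nth 0 s i)).

Section Clock.
Variables (O : Type) (lt : O -> O -> Prop).

(* The games are open for player I, so "II has a winning strategy" is the greatest
   fixpoint of one round.  The clock of I descends along an arbitrary relation lt; the
   always true relation on unit gives the infinite game.

   WF: I plays n, II plays a finite list G of vectors in Z n and a vector w in the span of
   all lists played so far; the vectors w must stay K-equivalent to an initial part of y.

   WH: II plays m, I plays n and a list A in M m, II answers with images B of A in the
   span of lists G taken from N n; the lists A and B must stay K-equivalent.

   WT: II only has to climb in the tree of sequences of N that are K-equivalent to z. *)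
Section WF.
Variables (y : nat -> V) (Z : nat -> set V) (K : nat).

Definition stepF (S : O -> seq V -> seq V -> Prop) x v F :=
  eqv K%:R (size v) (E v) (fun i => ev e (y i)) /\
  forall x' n, lt x' x -> exists G w,
    [/\ forall g, g \in G -> Z n g, span (F ++ G) w & S x' (rcons v w) (F ++ G)].

Definition WF x v F := exists S : O -> seq V -> seq V -> Prop,
  S x v F /\ forall x v F, S x v F -> stepF S x v F.

Lemma WF_step x v F : WF x v F -> stepF WF x v F.
Proof.
move=> [S [Sx hS]]; have [h1 h2] := hS _ _ _ Sx; split=> // x' n /(h2 _ n)[G [w [a b c]]].
by exists G, w; split=> //; exists S.
Qed.
End WF.

Section WH.
Variables (M N : nat -> set V) (K : nat).

Definition stepH (S : O -> seq V -> seq V -> seq V -> Prop) x a b F :=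
  [/\ size a = size b, eqv K%:R (size a) (E a) (E b) & exists m,
  forall x' n A, lt x' x -> (forall v, v \in A -> M m v) -> exists B G,
    [/\ size B = size A, forall g, g \in G -> N n g,
        forall w, w \in B -> span (F ++ G) w & S x' (a ++ A) (b ++ B) (F ++ G)]].

Definition WH x a b F := exists S : O -> seq V -> seq V -> seq V -> Prop,
  S x a b F /\ forall x a b F, S x a b F -> stepH S x a b F.

Lemma WH_step x a b F : WH x a b F -> stepH WH x a b F.
Proof.
move=> [S [Sx hS]]; have [h1 h2 [m h3]] := hS _ _ _ _ Sx; split=> //; exists m.
move=> x' n A lx hA; have [B [G [g1 g2 g3 g4]]] := h3 x' n A lx hA.
by exists B, G; split=> //; exists S.
Qed.
End WH.

Section WT.
Variables (z : nat -> V) (N : set V) (K : nat).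

Definition stepT (S : O -> seq V -> Prop) x v :=
  eqv K%:R (size v) (E v) (fun i => ev e (z i)) /\
  forall x', lt x' x -> exists w, N w /\ S x' (rcons v w).

Definition WT x v := exists S : O -> seq V -> Prop,
  S x v /\ forall x v, S x v -> stepT S x v.

Lemma WT_step x v : WT x v -> stepT WT x v.
Proof.
move=> [S [Sx hS]]; have [h1 h2] := hS _ _ Sx; split=> // x' /h2 [w [a b]].
by exists w; split=> //; exists S.
Qed.
End WT.

Lemma WF_les y Z Z' K x v F : les Z' Z -> WF y (sp Z') K x v F -> WF y (sp Z) K x v F.
Proof.
move=> lZ h; exists (WF y (sp Z') K); split=> // {h} {}x {}v {}F /WF_step[h1 h2]; split=> //.
move=> x' n lx; have [m hm] := lZ n.
have [G [w [g1 g2 g3]]] := h2 x' m lx; exists G, w; split=> // g /g1; exact: hm.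
Qed.

Lemma WF_mono_clock y Z K x x' v F : (forall c, lt c x' -> lt c x) ->
  WF y Z K x v F -> WF y Z K x' v F.
Proof.
move=> h hx; exists (fun c u G => WF y Z K c u G \/ c = x' /\ u = v /\ G = F).
split; first by right.
move=> c u G [/WF_step|[-> [-> ->]]].
  move=> [h1 h2]; split=> // c' n lc; have [G' [w [g1 g2 g3]]] := h2 c' n lc.
  by exists G', w; split=> //; left.
have [h1 h2] := WF_step hx; split=> // c' n /h lc.
have [G' [w [g1 g2 g3]]] := h2 c' n lc.
by exists G', w; split=> //; left.
Qed.

Lemma WH_les M M' N N' K x a b F :
  les M' M -> les N' N ->
  WH (sp M) (sp N') K x a b F -> WH (sp M') (sp N) K x a b F.
Proof.
move=> lM lN h; exists (WH (sp M) (sp N') K); split=> // {h} {}x {}a {}b {}F.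
move=> /WH_step [h1 h2 [m h3]]; split=> //; have [m' hm'] := lM m; exists m'.
move=> x' n A lx hA; have [n' hn'] := lN n.
have [|B [G [g1 g2 g3 g4]]] := h3 x' n' A lx; first by move=> v /hA /hm'.
by exists B, G; split=> // g /g2 /hn'.
Qed.

End Clock.

Lemma WF_clock (O O' : Type) (lt : O -> O -> Prop) (lt' : O' -> O' -> Prop) (g : O' -> O)
    y Z K x v F : (forall c d, lt' c d -> lt (g c) (g d)) ->
  WF lt y Z K (g x) v F -> WF lt' y Z K x v F.
Proof.
move=> hg h; exists (fun x => WF lt y Z K (g x)); split=> // {h} {}x {}v {}F.
move=> h; have [h1 h2] := WF_step h; split=> // x' n /hg /(h2 _ n).
by move=> [G [w [a b c]]]; exists G, w.
Qed.

Lemma WT_clock (O O' : Type) (lt : O -> O -> Prop) (lt' : O' -> O' -> Prop) (g : O' -> O)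
    y Z K x v : (forall c d, lt' c d -> lt (g c) (g d)) ->
  WT lt y Z K (g x) v -> WT lt' y Z K x v.
Proof.
move=> hg h; exists (fun x => WT lt y Z K (g x)); split=> // {h} {}x {}v.
move=> h; have [h1 h2] := WT_step h; split=> // x' /hg /h2.
by move=> [w [a b]]; exists w.
Qed.

Section Clock2.
Variables (O : Type) (lt : O -> O -> Prop).
Local Notation olt := (omega_times lt).

(** I is made to repeat [n] for [d] rounds, counting down only the second coordinate of the
    clock. *)
Lemma WF_run y Z K x k u F n d :
  WF olt y Z K (x, (k + d)%N) u F -> exists u' G,
    [/\ size u' = d, forall g, g \in G -> Z n g, forall w, w \in u' -> span (F ++ G) w &
        WF olt y Z K (x, k) (u ++ u') (F ++ G)].
Proof.
elim: d u F => [|d IH] u F h.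
  by exists [::], [::]; rewrite !cats0; split=> //; rewrite addn0 in h.
have [_ /(_ (x, (k + d)%N) n)[|G [w [g1 g2 /IH]]]] := WF_step h.
  by right; split=> //=; rewrite addnS.
move=> [u' [G' [k1 k2 k3 k4]]]; exists (w :: u'), (G ++ G'); rewrite catA -cat_rcons /= k1.
split=> //.
  by move=> g; rewrite mem_cat => /orP[/g1|/k2].
move=> w'; rewrite inE => /predU1P[->|/k3 //]; exact: span_catl.
Qed.

(* Between two moves of the clock x there are omega many spare rounds; they are
   spent on embedding as many terms of y as the vectors in A involve. *)
Lemma WF_WH y Z K x F : WF olt y Z K (x, 0%N) [::] F ->
  WH lt (fun _ => sp y 0) Z K x [::] [::] F.
Proof.
(* [r] holds the coordinates over [y] of the vectors given by I; II answers with the same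
   coordinates over the vectors [u] of the first game. *)
move=> h0; pose S x (a b F : seq V) := exists u k (r : seq V),
  [/\ WF olt y Z K (x, k) u F, a = map (sub y) r, b = map (sub (nth 0 u)) r,
   forall p, p \in r -> (size p <= size u)%N & forall w, w \in u -> span F w].
exists S; split; first by exists [::], 0%N, [::].
move=> {h0} {}x a b {}F [u [k [r [hu -> -> hr uF]]]].
have sr i : (i < size r)%N -> (size (nth 0%R r i) <= size u)%N by move=> h; rewrite hr // mem_nth.
have [hu1 hu2] := WF_step hu; split; first by rewrite !size_map.
  rewrite size_map; apply: (eq_eqv _ (eqv_ev sr (eqv_sym hu1))).
  move=> i lt_i; rewrite !(nth_map 0) // !ev_sub; split=> //.
exists 0%N => x' n A lx hA.
have [rA erA] : exists rA, A = map (sub y) rA.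
  elim: A hA => [|v A IH] hA; first by exists [::].
  have [|rA ->] := IH; first by move=> w wA; apply: hA; rewrite inE wA orbT.
  have [|p [_ ->]] := hA v; first by rewrite inE eqxx.
  by exists (p :: rA).
pose d := (\max_(p <- rA) size p)%N.
(* The clock drops to [x'] with [d] spare rounds, where [d] is chosen after [A] is known: enough
   vectors to evaluate all of [rA]. *)
have [|G0 [w0 [g1 g2 g3]]] := hu2 (x', (0 + d)%N) n; first by left.
have [u' [G1 [k1 k2 k3 k4]]] := WF_run n g3.
have uw w : w \in rcons u w0 ++ u' -> span ((F ++ G0) ++ G1) w.
  rewrite mem_cat mem_rcons inE => /orP[/predU1P[->|/uF h]|/k3 //]; first exact: span_catl.
  by do 2!apply: span_catl.
exists (map (sub (nth 0 (rcons u w0 ++ u'))) rA), (G0 ++ G1).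
rewrite erA !size_map catA; split=> //.
- by move=> g; rewrite mem_cat => /orP[/g1|/k2].
- move=> w /mapP[p pr ->]; apply: span_sub => //.
  rewrite size_cat size_rcons k1 (leq_trans _ (leq_addl _ _)) //.
  by rewrite /d; apply: (@leq_bigmax_seq _ _ xpredT (fun p : V => size p)).
exists (rcons u w0 ++ u'), 0%N, (r ++ rA); split=> //.
- by rewrite map_cat.
- rewrite map_cat; congr (_ ++ _); apply/eq_in_map => p /hr hp.
  by rewrite -cats1 -catA sub_catl.
- move=> p; rewrite mem_cat size_cat size_rcons k1 => /orP[/hr h|pr].
    by rewrite (leq_trans h) // addSn -addnS leq_addr.
  rewrite (leq_trans _ (leq_addl _ _)) //.
  by rewrite /d; apply: (@leq_bigmax_seq _ _ xpredT (fun p : V => size p)).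
Qed.

(* The vectors embedded by II in the first game are the moves of I in the second. *)
Lemma WH_comp M N y K1 K2 (z : nat -> V) x :
  (forall i, sp y 0 (z i)) ->
  WH lt (fun _ => sp y 0) (sp M) K1 x [::] [::] [::] ->
  WH lt (sp M) (sp N) K2 x [::] [::] [::] ->
  WT lt z (sp N 0) (K1 * K2)%N x [::].
Proof.
(* The list [F] of II in the first game is what I plays in the second, where it is answered by [c].
   The image [b] of [z] has coordinates [r] over [F], so [v] takes these coordinates over [c]. *)
move=> hz h1 h2; pose S x (v : seq V) := exists b F (r c G : seq V),
  [/\ WH lt (fun _ => sp y 0) (sp M) K1 x (mkseq z (size v)) b F,
      WH lt (sp M) (sp N) K2 x F c G,
      [/\ b = map (sub (nth 0 F)) r, v = map (sub (nth 0 c)) r &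
      forall p, p \in r -> (size p <= size F)%N], forall w, w \in c -> sp N 0 w &
      forall w, w \in G -> sp N 0 w].
exists S; split; first by exists [::], [::], [::], [::], [::]; split.
move=> {h1 h2} {}x v [b [F [r [c [G [h1 h2 [eb ev_ hr] hc hG]]]]]].
have [s1 q1 [_ p1]] := WH_step h1; have [s2 q2 [m p2]] := WH_step h2.
have sv : size v = size r by rewrite ev_ size_map.
split.
  apply: (@eqv_mono _ _ (K2%:R * K1%:R)); first by rewrite mulnC natrM.
  apply: (@eqv_trans _ _ _ _ _ _ (fun i => ev e (nth 0 b i))) => //.
    have sr i : (i < size r)%N -> (size (nth 0%R r i) <= size F)%N by move=> h; rewrite hr // mem_nth.
    rewrite sv; apply: (eq_eqv _ (eqv_ev sr (eqv_sym q2))) => i lt_i.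
    by rewrite ev_ eb !(nth_map 0) // !ev_sub.
  rewrite size_mkseq in q1; apply: (eq_eqv _ (eqv_sym q1)) => i lt_i.
  by rewrite nth_mkseq.
move=> x' lx; have [|B [G1 [sB t1 t2 t3]]] := p1 x' m [:: z (size v)] lx.
  by move=> w; rewrite inE => /eqP ->.
case: B sB t2 t3 => [|w [|]] //= _ t2 t3.
have [p [hp ew]] : span (F ++ G1) w by apply: t2; rewrite inE.
have [|C [G2 [sC u1 u2 u3]]] := p2 x' 0%N G1 lx; first by move=> g /t1.
have cN w' : w' \in c ++ C -> sp N 0 w'.
  rewrite mem_cat => /orP[/hc //|/u2]; apply: span_sp => g.
  by rewrite mem_cat => /orP[/hG //|/u1].
have sFC : size (F ++ G1) = size (c ++ C) by rewrite !size_cat s2 sC.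
exists (sub (nth 0 (c ++ C)) p); split.
  apply: sp_sub => i lt_i _; apply: cN; rewrite mem_nth //.
  by rewrite -sFC (leq_trans lt_i).
exists (rcons b w), (F ++ G1), (rcons r p), (c ++ C), (G ++ G2); split=> //.
- by rewrite size_rcons mkseqS -!cats1.
- rewrite !map_rcons ew; split.
  + by rewrite eb; congr rcons; apply/eq_in_map => q /hr hq; rewrite sub_catl.
  + by rewrite {1}ev_; congr rcons; apply/eq_in_map => q /hr hq; rewrite sub_catl // -s2.
  + move=> q; rewrite mem_rcons inE => /predU1P[->//|/hr hq].
    by rewrite size_cat (leq_trans hq) // leq_addr.
- by move=> g; rewrite mem_cat => /orP[/hG //|/u1].
Qed.
End Clock2.

(* Winning positions in M, N form countable sets that shrink with N and grow with M, so
   they can be stabilized; after a second stabilization of the available answers one M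
   works for every N simultaneously. *)
Lemma WF_dense_uniform (O : countType) (lt : O -> O -> Prop) (al : O) X : bs X ->
  (forall Z, bs Z -> les Z X -> exists y K,
     [/\ bs y, les y Z & WF (omega_times lt) y (sp Z) K (al, 0%N) [::] [::]]) ->
  exists y K, [/\ bs y, les y X & forall N z, bs N -> les N y ->
    (forall i, sp y 0 (z i)) -> WT lt z (sp N 0) K al [::]].
Proof.
move=> bX P.
pose T := (nat * O * seq V * seq V * seq V)%type.
pose H M Z (t : T) := let '(K, x, a, b, F) := t in WH lt (sp M) (sp Z) K x a b F.
have Hles M' M Z' Z t : les M' M -> les Z' Z -> H M Z' t -> H M' Z t.
  by case: t => [[[[K x] a] b] F]; exact: WH_les.
pose sg Z : set T := [set t | exists M, [/\ bs M, les M Z & H M Z t]].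
have [|Y [bY lY sY]] := @stabilize T sg X bX.
  move=> y z by_ lz t [M [bM lM h]]; exists M; split=> //; first exact: les_trans lz.
  exact: Hles (les_refl _) lz h.
have star N : bs N -> les N Y -> exists M, [/\ bs M, les M N & forall t, sg Y t -> H M N t].
  move=> bN lN.
  have [||M [bM lM hM]] := @fusion_count T (fun t M => sg Y t -> H M N t) N _ _ bN.
  - by move=> t y z by_ lz h /h; apply: Hles => //; exact: les_refl.
  - move=> t Z bZ lZ; have [|nt] := pselect (sg Y t); last by exists Z; split=> //; exact: les_refl.
    rewrite -(sY Z bZ (les_trans lZ lN)) => -[M [bM lM h]]; exists M; split=> // _.
    exact: Hles (les_refl _) lZ h.
  by exists M.
pose T' := (nat * O * seq V * seq V * seq V * seq V)%type.
(* Membership in [sg N] hides a witness depending on [N]. [tau] records instead that an answer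
   staying in [sg Y] exists arbitrarily far out in [N]; once it is constant, the threshold [m] found
   for one [N] serves for all. *)
pose tau N : set T' := [set t | let '(K, x, A, a, b, F) := t in
  forall n, exists B G, [/\ size B = size A, forall g, g \in G -> sp N n g,
        forall w, w \in B -> span (F ++ G) w & sg Y (K, x, a ++ A, b ++ B, F ++ G)]].
have [|Y' [bY' lY' sY']] := @stabilize T' tau Y bY.
  move=> y z by_ lz [[[[[K x] A] a] b] F] h n; have [m hm] := lz n.
  have [B [G [g1 g2 g3 g4]]] := h m; exists B, G; split=> // g /g2; exact: hm.
have [M [bM lM hM]] := star Y' bY' lY'.
have MN N t : bs N -> les N Y' -> sg Y t -> H M N t.
  move=> bN lN; case: t => [[[[K x] a] b] F] st.
  exists (fun x a b F => sg Y (K, x, a, b, F)); split=> // {st} {}x {}a {}b {}F st.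
  have [h1 h2 [m h3]] := WH_step (hM _ st); split=> //; exists m => x' n A lx hA.
  suff : tau Y' (K, x', A, a, b, F) by rewrite -(sY' N bN lN) => /(_ n).
  move=> k; have [B [G [g1 g2 g3 g4]]] := h3 x' k A lx hA; exists B, G; split=> //.
  by rewrite -(sY Y' bY' lY'); exists M.
(* [y1] only serves to put the empty position into [sg Y]; from there [M] takes over. *)
have [y1 [K1 [by1 ly1 wy1]]] := P Y bY lY; have hy1 := WF_WH wy1.
have st : sg Y (K1, al, [::], [::], [::]).
  exists y1; split=> //; case: hy1 => S [S0 hS]; exists S; split=> // x a b F /hS.
  move=> [g1 g2 [m h]]; split=> //; exists m => x' n A lx hA; apply: h => // v /hA.
  exact: sp_mono.
have lMX : les M X by apply: les_trans lM (les_trans lY' lY).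
(* The hypothesis is used again, now inside [M]: [y] embeds into [M], and [M] into every [N]. *)
have [y [K2 [by_ ly wy]]] := P M bM lMX; have hy := WF_WH wy.
exists y, (K2 * K1)%N; split=> //; first exact: les_trans lMX.
move=> N z bN lN hz; apply: WH_comp hz hy _.
by apply: (MN N (K1, al, [::], [::], [::])) => //; apply: les_trans lN (les_trans ly lM).
Qed.
End Games.

(** * An uncountable well-order with countable segments *)

Lemma well_order_seg (O : Type) (lt : O -> O -> Prop) a : well_order lt ->
  well_order (fun x y : {b | lt b a} => lt (sval x) (sval y)).
Proof.
move=> [wf [ltr tri]]; split.
  move=> [x]; elim/(well_founded_ind wf): x => x IH hx; constructor=> -[y hy] yx.
  exact: IH.
split=> [x y z|x y]; first exact: ltr.
case: (tri (sval x) (sval y)) => [|[|]]; [by left| |by right; right].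
by case: x y => [x hx] [y hy] /= e; right; left; apply: eq_exist.
Qed.

(** Well-order [nat -> bool], which is uncountable by Cantor; if some proper initial segment is
    uncountable, cut at the least such point. *)
Lemma first_uncountable : exists (O : Type) (lt : O -> O -> Prop),
  [/\ well_order lt, forall a, countable_type {b | lt b a} & ~ countable_type O].
Proof.
pose U := {classic (nat -> bool)}.
have [r wr] := wochoice.well_ordering_principle U.
have min2 x y : exists z, [/\ z = x \/ z = y, r z x & r z y].
  have [|z [[+ hz] _]] := wr (fun w => (w == x) || (w == y)); first by exists x; rewrite unfold_in /= eqxx.
  rewrite unfold_in /= => zz; exists z; split; first by case/orP: zz => /eqP; [left|right].
  - by apply: hz; rewrite unfold_in /= eqxx.
  - by apply: hz; rewrite unfold_in /= eqxx orbT.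
have rxx x : r x x by have [z [[->|->]]] := min2 x x.
have tot x y : r x y \/ r y x by have [z [[->|->]]] := min2 x y; [left|right].
have anti x y : r x y -> r y x -> x = y.
  move=> xy yx; have [|z [_ hz]] := wr (fun w => (w == x) || (w == y)).
    by exists x; rewrite unfold_in /= eqxx.
  rewrite -(hz x); last first.
    by split=> [|w]; rewrite unfold_in /= ?eqxx // => /orP[] /eqP->.
  apply: hz; split=> [|w]; rewrite unfold_in /= ?eqxx ?orbT // => /orP[] /eqP-> //.
have minA (A : U -> Prop) : (exists x, A x) -> exists z, A z /\ forall x, A x -> r z x.
  move=> [x Ax]; have [|z [[Az hz] _]] := wr (fun w => `[< A w >]).
    by exists x; rewrite unfold_in; apply/asboolP.
  by exists z; split=> [|w Aw]; [apply/asboolP|apply: hz; apply/asboolP].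
have tr x y z : r x y -> r y z -> r x z.
  move=> xy yz; have [w [wA hw]] := minA (fun w => w = x \/ w = y \/ w = z) (ex_intro _ x (or_introl erefl)).
  have [wx wy wz] : [/\ r w x, r w y & r w z] by split; apply: hw; auto.
  case: wA => [e|[e|e]]; subst w => //.
    by rewrite (anti x y).
  by rewrite -(anti _ _ yz wy).
pose lt x y := r x y /\ x <> y.
have wf : well_founded lt.
  move=> a; apply: contrapT => na.
  have [z [nz hz]] := minA (fun x => ~ Acc lt x) (ex_intro _ a na).
  apply: nz; constructor => y [yz ne]; apply: contrapT => ny; apply: ne.
  exact: anti (hz _ ny).
have ltr a b c : lt a b -> lt b c -> lt a c.
  move=> [ab nab] [bc nbc]; split; first exact: tr bc.
  by move=> ac; apply: nab; apply: anti => //; rewrite ac.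
have tri a b : lt a b \/ a = b \/ lt b a.
  have [->|ne] := pselect (a = b); first by right; left.
  by case: (tot a b) => h; [left|right; right]; split=> // e; apply: ne.
have wo : well_order lt by [].
have unc : ~ countable_type U.
  move=> [f injf]; pose d n := ~~ `[< exists2 s : U, f s = n & (s : nat -> bool) n >].
  have := erefl (d (f d)); rewrite {1}/d; case: asboolP => /= [[s /injf -> ->]//|h].
  by move=> dd; case: h; exists d.
have [cseg|/existsNP[a0 na0]] := pselect (forall a, countable_type {b | lt b a}).
  by exists U, lt.
have [a [na ha]] := minA (fun a => ~ countable_type {b | lt b a}) (ex_intro _ a0 na0).
pose O := {b | lt b a}; pose lt' (x y : O) := lt (sval x) (sval y).
have wo' : well_order lt' by exact: well_order_seg.
have nO : ~ countable_type O by exact: na.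
exists O, lt'; split; [exact: wo'| |exact: nO].
move=> [b ba]; apply: contrapT => nb; case: (ba) => _; apply.
apply: anti; first by have [] := ba.
apply: ha => -[f injf]; apply: nb.
exists (fun x : {c : O | lt' c (exist _ b ba)} => f (exist _ (sval (sval x)) (svalP x))).
move=> [[x hx] hx'] [[y hy] hy'] /injf e; have /= {}e := congr1 sval e.
by apply: eq_exist; apply: eq_exist.
Qed.

Section Omega.
Variables (O : Type) (lt : O -> O -> Prop).
Hypotheses (wo : well_order lt) (seg : forall a, countable_type {b | lt b a})
  (unc : ~ countable_type O).

(** A cofinal [g] would make [O] a countable union of countable segments: [b] is coded by some [t]
    with [b] at most [g t] and its number below [g t], with 0 reserved for equality. *)
Lemma countable_bounded (T : countType) (g : T -> O) : exists b, forall t, lt (g t) b.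
Proof.
apply: contrapT => nb; apply: unc.
have H b : exists t, b = g t \/ lt b (g t).
  apply: contrapT => h; apply: nb; exists b => t.
  have [_ [_ tri]] := wo; case: (tri (g t) b) => [//|h']; case: h; exists t.
  by case: h' => h'; [left|right].
have [tt htt] := choice H; pose F a := sval (cid (seg a)).
have hF a : injective (F a) by exact: svalP (cid (seg a)).
pose code b := if pselect (lt b (g (tt b))) is left h then (F _ (exist _ b h)).+1 else 0%N.
exists (fun b => pickle (tt b, code b)) => b c /(pcan_inj pickleK) [e].
rewrite /code e; case: pselect => hb; case: pselect => hc //; last first.
  have root d : ~ lt d (g (tt d)) -> d = g (tt d) by case: (htt d).
  by move=> _; rewrite (root _ hc) -e; apply: root; rewrite e.
by case=> /hF [].
Qed.

(** Every [t] that ever leaves [D] leaves at some stage, and countably many stages are bounded. *)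
Lemma stationary (T : countType) (D : O -> set T) :
  (forall x y, lt x y -> D y `<=` D x) -> exists a, forall x, D a `<=` D x.
Proof.
move=> mono.
have H t : exists a, forall x, ~ D x t -> ~ D a t.
  have [[a na]|h] := pselect (exists a, ~ D a t); first by exists a.
  (* The empty family supplies an element of [O]. *)
  have [a _] := countable_bounded (fun u : void => match u return O with end).
  by exists a => x nx; case: h; exists x.
have [g hg] := choice H; have [a ha] := countable_bounded g.
exists a => x t at_; apply: contrapT => /hg; apply; exact: mono at_.
Qed.

End Omega.

Lemma sp_above z n (v : V) : bs z -> sp z 0 v ->
  (forall i, (i < size (z n))%N -> v`_i = 0) -> sp z n v.
Proof.
move=> bz [p [_ ->]] h; exists p; split=> // i lt_i.
apply/eqP; apply: contraT => nz.
have lt_ip : (i < size p)%N by rewrite ltnNge; apply: contra nz => /(nth_default 0) ->.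
have zi0 : size (z i) != 0%N by rewrite size_poly_eq0; have [] := bz i.
have := h (size (z i)).-1; rewrite /sub coef_sum.
rewrite (bigD1 (Ordinal lt_ip)) //= coefZ big1 ?addr0 => [|j /eqP ne]; last first.
  rewrite coefZ; have [lt_ji|lt_ij|eji] := ltngtP j i.
  - rewrite [(z j)`__]nth_default ?mulr0 //.
    rewrite -ltnS prednK ?lt0n //.
    exact: leq_trans (bs_size bz j) (bs_size_mono bz lt_ji).
  - by rewrite (bs_lo bz lt_ij) ?mulr0 // prednK ?lt0n.
  - by case: ne; apply: val_inj.
have lt_z : ((size (z i)).-1 < size (z n))%N.
  by rewrite prednK ?lt0n // bs_size_mono // ltnW.
move=> /(_ lt_z) /eqP; rewrite mulf_eq0 (negbTE nz) /= -lead_coefE lead_coef_eq0.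
by rewrite (negbTE (bz i).1).
Qed.

(** Supports of a block sequence escape every bound, so membership in [sp z 0] improves to
    membership in [sp z n] further out. *)
Lemma les_of_gen y z m : bs y -> bs z -> (forall i, (m <= i)%N -> sp z 0 (y i)) -> les y z.
Proof.
move=> by_ bz h n; exists (maxn m (size (z n))); apply: sp_min => i; rewrite geq_max.
move=> /andP[le_mi le_ni]; apply: sp_above => // [|j lt_j]; first exact: h.
by apply: (sp_lo0 by_ (sp_gen _ (leqnn i))); apply: leq_trans le_ni.
Qed.

(** * From all countable clocks to the infinite game *)

Section Infinite.
Variables (R : realType) (W : normedModType R) (e : nat -> W).
Variables (O : Type) (lt : O -> O -> Prop).
Hypotheses (wo : well_order lt) (seg : forall a, countable_type {b | lt b a})
  (unc : ~ countable_type O).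
Local Notation olt := (omega_times lt).

(* A node records finitely many terms of y together with finitely many positions
   reached by II.  The nodes that II can keep alive for every countable clock form a
   nonempty set without terminal elements; a branch meeting all the moves of I is a
   sequence y with a strategy for the infinite game. *)
Lemma WF_all_clocks Z : bs Z ->
  (forall al, exists y K, [/\ bs y, les y Z & WF e olt y (sp Z) K (al, 0%N) [::] [::]]) ->
  exists y K, [/\ bs y, les y Z &
    WF e (fun _ _ : unit => True) y (sp Z) K tt [::] [::]].
Proof.
move=> bZ P.
have [_ [ltr _]] := wo.
pose T := (nat * nat * seq V * seq (seq V * seq V))%type.
(* Positions in [Q] are no longer than [u], so their equivalence involves recorded terms of [y]
   only. *)
pose D (x : O) : set T := [set t : T | let '(K, m, u, Q) := t in exists y,
  [/\ bs y, forall i, (m <= i)%N -> sp Z 0 (y i), u = mkseq y (size u) &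
   forall q, q \in Q -> WF e olt y (sp Z) K (x, 0%N) q.1 q.2 /\ (size q.1 <= size u)%N]].
have [|a Da] := @stationary O lt wo seg unc T D.
  move=> x x' lx [[[K m] u] Q] [y [by_ hy eu hQ]]; exists y; split=> // q /hQ[h1 h2].
  split=> //; apply: WF_mono_clock h1 => -[c k] /= [|[_ //]]; move=> /= h; left.
  exact: ltr lx.
have [K [m D0]] : exists K m, D a (K, m, [::], [:: ([::], [::])]).
  have [y [K [by_ ly hy]]] := P a; have [m hm] := ly 0%N; exists K, m, y; split=> //.
    by move=> i h; apply: hm; apply: sp_gen.
  by move=> q; rewrite inE => /eqP ->.
(* A node of [D a] also lies in [D a']; one round, from clock [a'] down to [a], extends it inside
   [D a]. *)
have [a' haa'] := countable_bounded wo seg unc (fun _ : unit => a).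
have step (t : nat * (seq V * seq (seq V * seq V))) : exists t' : seq V * seq (seq V * seq V),
    let: (k, (u, Q)) := t in
    (* Bookkeeping: [k.+1 = 2 ^ j * (2 n + 1)] gives each pair of a position [j] and a move [n]
       exactly one stage. *)
    let j := logn 2 k.+1 in let n := (k.+1 %/ 2 ^ j)./2 in
    D a (K, m, u, Q) -> (j < size Q)%N ->
    exists w q G, [/\ t' = (rcons u w, rcons Q (rcons (nth ([::],[::]) Q j).1 q, (nth ([::],[::]) Q j).2 ++ G)),
      D a (K, m, t'.1, t'.2), forall g, g \in G -> sp Z n g &
      span ((nth ([::],[::]) Q j).2 ++ G) q].
  case: t => k [u Q] /=; set j := logn _ _; set n := _./2.
  have [[Du lt_j]|nD] := pselect (D a (K, m, u, Q) /\ (j < size Q)%N); last first.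
    by exists (u, Q) => h1 h2; case: nD.
  have [y [by_ hy eu hQ]] := Da a' _ Du.
  have [h1 h2] := hQ _ (mem_nth ([::],[::]) lt_j).
  have [_ /(_ (a, 0%N) n)[|G [w [g1 g2 g3]]]] := WF_step h1; first by left; exact: haa'.
  eexists; move=> _ _; exists (y (size u)), w, G; split=> //=.
  exists y; split=> //; first by rewrite size_rcons mkseqS -eu.
  move=> q; rewrite mem_rcons inE => /predU1P[->|/hQ [q1 q2]] /=.
    by split=> //; rewrite !size_rcons.
  split; last by rewrite size_rcons (leq_trans q2).
  apply: WF_mono_clock q1 => -[c k'] /= [|[_ //]] /= h; left.
  exact: ltr (haa' tt).
have [f hf] := choice step.
pose s := fix s k := if k is k'.+1 then f (k', s k') else ([::], [:: ([::], [::])]).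
have lj k : (logn 2 k.+1 < k.+1)%N by rewrite ltn_logl.
have S k : [/\ D a (K, m, (s k).1, (s k).2), size (s k).1 = k & size (s k).2 = k.+1].
  elim: k => [|k [IH1 IH2 IH3]]; first by [].
  have := hf (k, s k) => /=; case: (s k) IH1 IH2 IH3 => u Q /= IH1 IH2 IH3 /(_ IH1).
  rewrite IH3 => /(_ (lj k))[w [q [G [-> h1 _ _]]]] /=; split=> //; by rewrite size_rcons ?IH2 ?IH3.
have su k : exists w, (s k.+1).1 = rcons (s k).1 w.
  have [h1 h2 h3] := S k; have := hf (k, s k) => /=; case: (s k) h1 h2 h3 => u Q /= h1 h2 h3 /(_ h1).
  by rewrite h3 => /(_ (lj k))[w [q [G [-> _ _ _]]]]; exists w.
pose y i := nth 0 (s i.+1).1 i.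
have sy k : (s k).1 = mkseq y k.
  elim: k => [//|k IH]; have [w ew] := su k; rewrite mkseqS /y ew IH.
  by rewrite nth_rcons size_mkseq ltnn eqxx.
have wit k : exists y', [/\ bs y', forall i, (m <= i)%N -> sp Z 0 (y' i),
   forall i, (i < k)%N -> y i = y' i &
   forall q, q \in (s k).2 -> WF e olt y' (sp Z) K (a, 0%N) q.1 q.2 /\ (size q.1 <= k)%N].
  have [[y' [b1 b2 b3 b4]] h2 h3] := S k; exists y'; split=> //.
    move=> i lt_i; move: b3; rewrite h2 sy => /(congr1 (fun l => nth 0 l i)).
    by rewrite !nth_mkseq.
  by move=> q /b4; rewrite h2.
have by_ : bs y.
  move=> n; have [y' [b1 _ b3 _]] := wit n.+2; rewrite !b3 //; exact: b1.
exists y, K; split=> //.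
  apply: (@les_of_gen y Z m) => // i le_mi; have [y' [b1 b2 b3 _]] := wit i.+1.
  by rewrite b3 //; apply: b2.
have sQ k k' j : (k <= k')%N -> (j < k.+1)%N -> nth ([::],[::]) (s k').2 j = nth ([::],[::]) (s k).2 j.
  move=> le_k lt_j; elim: k' le_k => [|k' IH]; first by rewrite leqn0 => /eqP->.
  rewrite leq_eqVlt => /predU1P[->//|lt_k]; rewrite -IH //.
  have [h1 h2 h3] := S k'; have := hf (k', s k') => /=.
  case: (s k') h1 h2 h3 => u Q /= h1 h2 h3 /(_ h1).
  rewrite h3 => /(_ (lj k'))[w [q [G [-> _ _ _]]]] /=.
  by rewrite nth_rcons h3 (leq_trans lt_j).
exists (fun _ v F => exists k, (v, F) \in (s k).2); split.
  by exists 0%N; rewrite inE.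
move=> x v F [k vk]; split.
  have [y' [b1 b2 b3 b4]] := wit k; have [h1 /= h2] := b4 _ vk; have [h3 _] := WF_step h1.
  apply: (eq_eqv _ h3) => i lt_i; split=> //; rewrite b3 //.
  exact: leq_trans h2.
move=> x' n _.
(* [k'] is the stage treating the move [n] at this position. It may precede [k], but [j < k'.+1], so
   the position is already listed. *)
pose j := index (v, F) (s k).2; pose k' := (2 ^ j * n.*2.+1).-1.
have k'1 : k'.+1 = (2 ^ j * n.*2.+1)%N by rewrite prednK // muln_gt0 expn_gt0.
have lj' : logn 2 k'.+1 = j.
  by rewrite k'1 lognM ?expn_gt0 // pfactorK // logn_coprime ?addn0 // coprime2n /= odd_double.
have ln' : (k'.+1 %/ 2 ^ j)./2 = n.
  by rewrite k'1 mulKn ?expn_gt0 //= uphalf_double.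
have lt_j : (j < k.+1)%N by have [_ _ <-] := S k; rewrite index_mem.
have [h1 h2 h3] := S k'; have := hf (k', s k') => /=.
have ej : nth ([::],[::]) (s k').2 j = (v, F).
  rewrite -(nth_index ([::],[::]) vk) -/j.
  have lt_j' : (j < k'.+1)%N by rewrite -lj'.
  have [le_kk|/ltnW le_kk] := leqP k k'; first exact: sQ.
  by rewrite -(sQ k' k).
rewrite lj' ln'.
have : s k'.+1 = f (k', s k') by [].
case: (s k') h1 h2 h3 ej => u Q /= h1 h2 h3 ej es /(_ h1).
rewrite h3 ej /=; have lt_j' : (j < k'.+1)%N by rewrite -lj'.
move=> /(_ lt_j')[w [q [G [ef _ g1 g2]]]]; exists G, q; split=> //; exists k'.+1.
by rewrite /= es ef /= mem_rcons inE eqxx.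
Qed.

End Infinite.

(** * Limits by estimates *)

Section Eps.
Variables (R : realType) (U : normedModType R).

Lemma closureP (A : set U) x :
  closure A x <-> forall eps, 0 < eps -> exists a, A a /\ `|x - a| < eps.
Proof.
split=> [cl eps eps0|h B /nbhs_ballP[eps /= eps0 hB]].
  have [|a [Aa xa]] := cl (ball x eps); first exact: nbhsx_ballx.
  by exists a; split=> //; move: xa; rewrite -ball_normE.
have [a [Aa xa]] := h _ eps0; exists a; split=> //; apply: hB.
by rewrite -ball_normE.
Qed.

Lemma cvg_epsP (u : nat -> U) l : u @ \oo --> l <->
  forall eps, 0 < eps -> exists N, forall n, (N <= n)%N -> `|l - u n| < eps.
Proof.
split=> [/cvgrPdist_lt h eps /h [N _ hN]|h]; first by exists N => n /hN.
by apply/cvgrPdist_lt => eps /h [N hN]; exists N => // n /= /hN.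
Qed.

Lemma half_pow_lt (B eps : R) : 0 < eps -> exists n, B * 2^-1 ^+ n < eps.
Proof.
move=> eps0; have := @archi_boundP R (`|B| / eps) (divr_ge0 (normr_ge0 _) (ltW eps0)).
move: (Num.Def.archi_bound _) => n hn; exists n.
have p0 : 0 < (2 : R) ^+ n by rewrite exprn_gt0.
rewrite exprVn ltr_pdivrMr //.
have : n%:R <= (2 : R) ^+ n by rewrite -natrX ler_nat ltnW // ltn_expl.
move: hn; rewrite ltr_pdivrMr // => hn hn2.
apply: le_lt_trans (ler_norm _) (lt_le_trans hn _).
by rewrite mulrC ler_wpM2l // ltW.
Qed.

Lemma norm_le_eps (x : U) (B : R) : (forall eps, 0 < eps -> `|x| <= B + eps) -> `|x| <= B.
Proof.
by move=> h; apply/ler_addgt0Pr => eps /h.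
Qed.

End Eps.

Lemma geometric_cvg (R : realType) (U : completeNormedModType R) (u : nat -> U) (B : R) :
  (forall n m, (n <= m)%N -> `|u m - u n| <= B * 2^-1 ^+ n) ->
  exists l, forall n, `|l - u n| <= B * 2^-1 ^+ n.
Proof.
move=> h.
have /cvg_ex [l /cvg_epsP hl] : cvg (u @ \oo).
  apply/cauchy_cvgP/cauchyP => eps eps0; have [n hn] := half_pow_lt B eps0.
  exists (u n); exists n => // m /= le_nm; rewrite -ball_normE /= distrC.
  exact: le_lt_trans (h _ _ le_nm) hn.
exists l => n; apply: norm_le_eps => eps /hl [N hN].
have /ltW hN' := hN (maxn N n) (leq_maxl _ _).
rewrite -(subrK (u (maxn N n)) l) -addrA addrC; apply: le_trans (ler_normD _ _) _.
by rewrite lerD // h // leq_maxr.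
Qed.

(** * Uniform boundedness of the basis projections *)

Section Basis.
Variables (R : realType) (W : completeNormedModType R) (e : nat -> W).

Lemma comb_cvg (u : nat -> nat -> R) (d : nat -> R) (B : nat -> R) n :
  (forall i k, `|d i - u k i| <= B i * 2^-1 ^+ k) -> forall eps, 0 < eps ->
  exists k0, forall k, (k0 <= k)%N -> `|comb n d e - comb n (u k) e| < eps.
Proof.
move=> h eps eps0; pose C := \sum_(i < n) B i * `|e i|.
have [k0 hk0] := half_pow_lt C eps0; exists k0 => k le_k.
have -> : comb n d e - comb n (u k) e = \sum_(i < n) (d i - u k i) *: e i.
  by rewrite /comb -sumrB; apply: eq_bigr => i _; rewrite scalerBl.
have B0 i : 0 <= B i by have := h i 0%N; rewrite expr0 mulr1; apply: le_trans.
apply: le_lt_trans hk0; apply: le_trans (ler_norm_sum _ _ _) _.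
rewrite mulr_suml; apply: ler_sum => i _; rewrite normrZ mulrAC ler_wpM2r //.
apply: le_trans (h i k) _; rewrite ler_wpM2l // ler_wiXn2l //; lra.
Qed.

(** As in the open mapping theorem: Baire gives a ball in the closure of one set [A k], and
    successive approximation carries the bound from the closure to every vector. *)
Lemma schauder_projections : schauder_basis e -> exists (cf : W -> nat -> R) (C : R),
  [/\ 1 <= C, forall a x y i, cf (a *: x + y) i = a * cf x i + cf y i,
      forall x n, `|comb n (cf x) e| <= C * `|x| &
      forall n c i, cf (comb n c e) i = if (i < n)%N then c i else 0].
Proof.
move=> be.
have [cf hcf] := choice be.
have cvf x : (fun n => comb n (cf x) e) @ \oo --> x by case: (hcf x).
have uni x a : (fun n => comb n a e) @ \oo --> x -> cf x = a by case: (hcf x) => _; apply.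
have lin a x y i : cf (a *: x + y) i = a * cf x i + cf y i.
  rewrite (uni _ (fun i => a * cf x i + cf y i)) //.
  have -> : (fun n => comb n (fun i => a * cf x i + cf y i) e) =
      (fun n => a *: comb n (cf x) e) + (fun n => comb n (cf y) e).
    by apply/funext => n; rewrite combD combZ.
  by apply: cvgD; [apply: cvgZr|].
have fin n c i : cf (comb n c e) i = if (i < n)%N then c i else 0.
  rewrite (uni _ (fun i => if (i < n)%N then c i else 0)) //.
  apply/cvg_epsP => eps eps0; exists n => m le_nm.
  by rewrite (comb_wide _ _ le_nm) subrr normr0.
have linS a x y n : comb n (cf (a *: x + y)) e = a *: comb n (cf x) e + comb n (cf y) e.
  rewrite -combZ -combD; apply: eq_comb => i _; by rewrite lin.
have z0 n : comb n (cf 0) e = 0.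
  have := linS 1 0 0 n; rewrite !scale1r addr0 => /eqP.
  by rewrite -subr_eq subrr eq_sym => /eqP.
pose A k : set W := [set x | forall n, `|comb n (cf x) e| <= k%:R].
have covA x : exists k, A k x.
  have /cvg_seq_bounded := cvgP _ (cvf x).
  move=> [M [_ /(_ (M + 1))]]; rewrite ltrDl => /(_ ltr01) hM.
  have := @archi_boundP R `|M + 1| (normr_ge0 _).
  move: (Num.Def.archi_bound _) => k hk; exists k => n.
  by apply: le_trans (hM n I) _; apply: le_trans (ler_norm _) (ltW hk).
have [k [x0 [r [r0 hr]]]] : exists k x0 r, 0 < r /\ forall x, `|x0 - x| < r -> closure (A k) x.
  apply: contrapT => nk.
  have dk k : open (~` closure (A k)) /\ dense (~` closure (A k)).
    split; first exact/closed_openC/closed_closure.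
    move=> O [x Ox] oO; apply: contrapT => nO; apply: nk.
    have /nbhs_ballP[r /= r0 hr] : nbhs x O by apply: open_nbhs_nbhs.
    exists k, x, r; split=> // y xy; apply: contrapT => ny; apply: nO; exists y; split=> //.
    by apply: hr; rewrite -ball_normE.
  have [||x [_ hx]] := Baire dk (O := setT); [by exists 0|exact: openT|].
  have [k Ak] := covA x; have := hx k I; apply; exact: subset_closure.
(* Vectors get rescaled to norm [r / 2], whence [2 k / r]; the added 1 keeps [M] positive when
   [k = 0]. *)
pose M : R := 2 * k%:R / r + 1.
have M0 : 0 < M by rewrite ltr_wpDl // divr_ge0 ?mulr_ge0 // ltW.
have ball0 x eps : `|x| < r -> 0 < eps -> exists a, A k a /\ `|x - a| < eps.
  move=> xr eps0; have [|a [Aa ha]] := (closureP (A k) (x0 + x)).1 (hr _ _) _ eps0.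
    by rewrite opprD addrA subrr add0r normrN.
  have [|b [Ab hb]] := (closureP (A k) (x0 - x)).1 (hr _ _) _ eps0.
    by rewrite opprB addrCA subrr addr0.
  (* Half the difference of approximants of [x0 + x] and [x0 - x] recentres the ball at 0; the [+ 0]
     fits the shape of [linS]. *)
  exists (2^-1 *: a + (2^-1 *: (- b) + 0)); split=> [n|].
    rewrite linS linS -(scaleN1r b) -[-1 *: b]addr0 linS.
    rewrite z0 !addr0 scaleN1r scalerN -scalerBr normrZ ger0_norm; last lra.
    have := ler_normB (comb n (cf a) e) (comb n (cf b) e).
    have := Aa n; have := Ab n => h1 h2 h3; lra.
  rewrite addr0 scalerN -scalerBr.
  have -> : x - 2^-1 *: (a - b) = 2^-1 *: ((x0 + x - a) - (x0 - x - b)).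
    have ex : x = 2^-1 *: ((x0 + x) - (x0 - x)).
      rewrite opprB (addrC x0) addrACA subrr addr0 -mulr2n -[x *+ 2]scaler_nat scalerA.
      by rewrite mulVf ?scale1r // pnatr_eq0.
    rewrite [X in X - _ = _]ex; move: (x0 + _) (x0 - _) => u v; rewrite -scalerBr !opprB.
    by congr (_ *: _); rewrite addrACA [in RHS]addrACA (addrC (- v)).
  rewrite normrZ ger0_norm; last lra.
  have := ler_normB (x0 + x - a) (x0 - x - b) => h; lra.
have approx x eps : 0 < eps -> exists a,
    (forall n, `|comb n (cf a) e| <= M * `|x|) /\ `|x - a| <= eps.
  move=> eps0; have [->|nx] := eqVneq x 0.
    exists 0; rewrite subrr normr0 mulr0 ltW //; split=> // n.
    by rewrite z0 normr0.
  have nx0 : 0 < `|x| by rewrite normr_gt0.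
  pose t := 2 * `|x| / r; have t0 : 0 < t by rewrite divr_gt0 ?mulr_gt0.
  have [|a [Aa ha]] := @ball0 (t^-1 *: x) (eps / t) _ (divr_gt0 eps0 t0).
    rewrite normrZ gtr0_norm ?invr_gt0 // /t invf_div.
    have -> : r / (2 * `|x|) * `|x| = r / 2 by field; rewrite gt_eqF.
    lra.
  exists (t *: a); split=> [n|].
    have := linS t a 0 n; rewrite addr0 => ->; rewrite z0 addr0 normrZ gtr0_norm //.
    have h : t * `|comb n (cf a) e| <= t * k%:R by rewrite ler_wpM2l // ltW.
    have -> : M * `|x| = t * k%:R + `|x| by rewrite /M /t; field; rewrite gt_eqF.
    lra.
  have -> : x - t *: a = t *: (t^-1 *: x - a).
    by rewrite scalerBr scalerA mulfV ?scale1r // gt_eqF.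
  by rewrite normrZ gtr0_norm // -ler_pdivlMl // mulrC ltW.
have enz i : 0 < `|e i|.
  rewrite normr_gt0; apply/negP => /eqP ei0.
  have := fin i.+1 (fun j => (j == i)%:R) i; rewrite ltnSn eqxx.
  rewrite /comb big_ord_recr /= ei0 scaler0 big1 => [|j _]; last first.
    by rewrite ltn_eqF // scale0r.
  have := fin 0%N (fun=> 0) i; rewrite /comb big_ord0 add0r => -> /eqP.
  by rewrite eq_sym oner_eq0.
have bnd x n : `|comb n (cf x) e| <= 2 * M * `|x|.
  have [->|nx] := eqVneq x 0; first by rewrite z0 !normr0 mulr0.
  have N0 : 0 < `|x| by rewrite normr_gt0.
  have pw j : 0 < 2^-1 ^+ j :> R by rewrite exprn_gt0 // invr_gt0.
  have [a ha] := choice (fun p : W * nat => approx p.1 (`|x| * 2^-1 ^+ p.2.+1) (mulr_gt0 N0 (pw _))).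
  (* The remainders of the successive approximation of [x]. *)
  pose X := fix X j := if j is j'.+1 then X j' - a (X j', j') else x.
  have Xb j : `|X j| <= `|x| * 2^-1 ^+ j.
    by case: j => [|j]; [rewrite expr0 mulr1|have [_] := ha (X j, j)].
  pose P n j := comb n (cf (X j)) e.
  have P1 m j : `|P m j - P m j.+1| <= M * `|x| * 2^-1 ^+ j.
    have [/(_ m) /= h _] := ha (X j, j); have := linS (-1) (a (X j, j)) (X j) m.
    rewrite scaleN1r addrC -/(X j.+1) -/(P m j.+1) => ->; rewrite scaleN1r opprD opprK addrCA subrr addr0.
    apply: le_trans h _; rewrite -mulrA ler_wpM2l //; exact: ltW.
  have P2 m j i : (j <= i)%N -> `|P m i - P m j| <= 2 * M * `|x| * (2^-1 ^+ j - 2^-1 ^+ i).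
    elim: i => [|i IH]; first by rewrite leqn0 => /eqP->; rewrite !subrr normr0 mulr0.
    rewrite leq_eqVlt => /predU1P[->|/IH h]; first by rewrite !subrr normr0 mulr0.
    have := P1 m i; rewrite distrC => h1.
    rewrite -(subrK (P m i) (P m i.+1)) -addrA.
    apply: le_trans (ler_normD _ _) _.
    have -> : 2^-1 ^+ i.+1 = 2^-1 ^+ i / 2 :> R by rewrite exprSr.
    move: h h1; move: (2^-1 ^+ i) (2^-1 ^+ j) => p q h h1.
    have -> : 2 * M * `|x| * (q - p / 2) = M * `|x| * p + 2 * M * `|x| * (q - p) by field.
    exact: lerD.
  have P3 m j i : (j <= i)%N -> `|P m i - P m j| <= 2 * M * `|x| * 2^-1 ^+ j.
    move=> /(P2 m) h; apply: le_trans h _; rewrite ler_wpM2l ?mulr_ge0 ?ltW // ?ltrBlDr ?ltrDl //.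
  pose B i := 4 * M * `|x| / `|e i|.
  have cB i j m : (j <= m)%N -> `|cf (X m) i - cf (X j) i| <= B i * 2^-1 ^+ j.
    move=> le_jm; rewrite /B mulrAC ler_pdivlMr // -normrZ scalerBl.
    have ec j' : cf (X j') i *: e i = P i.+1 j' - P i j' by rewrite /P /comb big_ord_recr /= addrAC subrr add0r.
    rewrite !ec; have := P3 i.+1 _ _ le_jm; have := P3 i _ _ le_jm.
    have := ler_normB (P i.+1 m - P i.+1 j) (P i m - P i j).
    have -> : P i.+1 m - P i m - (P i.+1 j - P i j) = P i.+1 m - P i.+1 j - (P i m - P i j).
      by rewrite !opprB addrACA [in RHS]addrACA (addrC (- P i m)).
    lra.
  have [l hl] := choice (fun i => @geometric_cvg R R^o (fun j => cf (X j) i) (B i) (cB i)).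
  have Q1 m j : `|comb m l e - P m j| <= 2 * M * `|x| * 2^-1 ^+ j.
    apply: norm_le_eps => eps /(comb_cvg m hl) [k0 hk0].
    have := hk0 (maxn k0 j) (leq_maxl _ _); have := P3 m _ _ (leq_maxr k0 j).
    have := ler_normD (comb m l e - P m (maxn k0 j)) (P m (maxn k0 j) - P m j).
    rewrite addrA subrK => h1 h2 /ltW h3; apply: le_trans h1 _; rewrite addrC; exact: lerD.
  (* The remainders tend to 0, so the series with the limit coefficients [l] sums to 0. Uniqueness
     of the expansion replaces continuity of the coordinates, not yet known. *)
  have l0 : cf 0 = l.
    apply: uni; apply/cvg_epsP => eps eps0.
    have [j hj] := half_pow_lt ((2 * M + 1) * `|x|) (divr_gt0 eps0 (ltr0n _ 2)).
    have [n0 hn0] := (cvg_epsP _ _).1 (cvf (X j)) _ (divr_gt0 eps0 (ltr0n _ 2)).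
    exists n0 => m /hn0 h1; rewrite sub0r normrN.
    have h2 := Q1 m j; have h3 := Xb j.
    have h4 := ler_normD (comb m l e - P m j) (X j - (X j - P m j)).
    have h5 := ler_normB (X j) (X j - P m j).
    move: h4; rewrite {1}subKr subrK.
    have : (2 * M + 1) * `|x| * 2^-1 ^+ j = 2 * M * `|x| * 2^-1 ^+ j + `|x| * 2^-1 ^+ j by ring.
    rewrite -/(P m j) in h1; lra.
  by have := Q1 n 0%N; rewrite -l0 z0 sub0r normrN expr0 mulr1.
exists cf, (2 * M + 1); split=> //; first lra.
move=> x n; apply: le_trans (bnd x n) _; rewrite ler_wpM2r //; lra.
Qed.
End Basis.

(** * Basic sequences, blocks and small perturbations *)

Section Basic.
Variables (R : realType) (W : normedModType R).
Implicit Types (s t u x : nat -> W) (c : nat -> R).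

(** Grunblum's criterion for a basic sequence with constant [C]. *)
Definition basic (C : R) s :=
  (forall i, s i != 0) /\
  forall n m c, (n <= m)%N -> `|comb n c s| <= C * `|comb m c s|.

Lemma basic_coef C s n c i : 1 <= C -> basic C s -> (i < n)%N ->
  `|c i| * `|s i| <= 2 * C * `|comb n c s|.
Proof.
move=> C1 [_ bs] lt_in.
have -> : `|c i| * `|s i| = `|comb i.+1 c s - comb i c s|.
  by rewrite /comb big_ord_recr /= addrAC subrr add0r normrZ.
apply: le_trans (ler_normB _ _) _.
have h1 := bs _ _ c lt_in; have h2 := bs _ _ c (ltnW lt_in); lra.
Qed.

Lemma basic_ge1 C s : basic C s -> 1 <= C.
Proof.
move=> [s0 bs]; have := bs 1%N 1%N (fun=> 1) (leqnn _).
rewrite -ler_pdivrMr ?divff ?normr_eq0 // ?normr_gt0 /comb big_ord1 scale1r //.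
Qed.

Lemma ev_neq0 C s (p : V) : basic C s -> p != 0 -> ev s p != 0.
Proof.
move=> bs p0; have sp0 : (0 < size p)%N by rewrite size_poly_gt0.
have lt_p : ((size p).-1 < size p)%N by rewrite prednK.
apply/negP => /eqP ep0; have := basic_coef (fun i => ratr p`_i) (basic_ge1 bs) bs lt_p.
rewrite -ev_wide // ep0 normr0 mulr0 -lead_coefE => h.
have : 0 < `|ratr (lead_coef p) : R| * `|s (size p).-1|.
  by rewrite mulr_gt0 // normr_gt0 ?(proj1 bs) // fmorph_eq0 lead_coef_eq0.
by rewrite ltNge h.
Qed.

(** Coefficients are controlled up to [2 * C], which the factor [d / (2 * C)] cancels; the weights
    [2^-1 ^+ i.+1] add up to less than 1. *)
Lemma comb_perturb C s t u n c (d : R) : basic C s -> 0 <= d ->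
  (forall i, (i < n)%N -> `|t i - u i| <= d / (2 * C) * 2^-1 ^+ i.+1 * `|s i|) ->
  `|comb n c t - comb n c u| <= d * `|comb n c s|.
Proof.
move=> bs d0 h; have C1 := basic_ge1 bs.
rewrite -combB /comb; apply: le_trans (ler_norm_sum _ _ _) _.
apply: (@le_trans _ _ (\sum_(i < n) d * `|comb n c s| * 2^-1 ^+ i.+1)).
  apply: ler_sum => i _; rewrite normrZ.
  have h1 := h i (ltn_ord i); have h2 := basic_coef c C1 bs (ltn_ord i).
  apply: le_trans (ler_wpM2l (normr_ge0 _) h1) _.
  have -> : `|c i| * (d / (2 * C) * 2^-1 ^+ i.+1 * `|s i|) = (d / (2 * C) * 2^-1 ^+ i.+1) * (`|c i| * `|s i|).
    by rewrite mulrCA.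
  have p0 : 0 <= d / (2 * C) * 2^-1 ^+ i.+1.
    by rewrite mulr_ge0 ?exprn_ge0 ?divr_ge0 // ?invr_ge0 //; lra.
  apply: le_trans (ler_wpM2l p0 h2) _; rewrite le_eqVlt; apply/orP; left; apply/eqP.
  by field; lra.
rewrite -mulr_sumr -[leRHS]mulr1 ler_wpM2l ?mulr_ge0 //.
have -> : \sum_(i < n) 2^-1 ^+ i.+1 = 1 - 2^-1 ^+ n :> R.
  elim: (n) => [|m IH]; first by rewrite big_ord0 expr0 subrr.
  by rewrite big_ord_recr /= IH exprS; field.
by rewrite lerBlDr lerDl exprn_ge0 // invr_ge0.
Qed.

Lemma eqv_near s t n : (forall c, `|comb n c t - comb n c s| <= 2^-1 * `|comb n c s|) ->
  eqv 2 n t s.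
Proof.
move=> h c; have {h} := h c; move: (comb n c t) (comb n c s) => a b h.
have := ler_normD (a - b) b; rewrite subrK; have := ler_normB a (a - b); rewrite subKr.
have := normr_ge0 b; split; lra.
Qed.

Lemma eqv_perturb C s t n : basic C s ->
  (forall i, (i < n)%N -> `|t i - s i| <= (4 * C)^-1 * 2^-1 ^+ i.+1 * `|s i|) -> eqv 2 n t s.
Proof.
move=> bs h; have C1 := basic_ge1 bs.
apply: eqv_near => c; apply: comb_perturb bs _ _; first lra.
move=> i /h; have -> : 2^-1 / (2 * C) = (4 * C)^-1 :> R; last by [].
field; lra.
Qed.

(* Small enough to pass from an equivalence with constant K to one with constant 2 K. *)
Lemma eqv_perturb_trans C K s t u n : basic C s -> 0 < K -> eqv K n u s ->
  (forall i, (i < n)%N -> `|t i - u i| <= (4 * C * K)^-1 * 2^-1 ^+ i.+1 * `|s i|) ->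
  eqv (2 * K) n t s.
Proof.
move=> bs K0 us h; apply: (eqv_trans _ _ _ us); [lra|lra|].
apply: eqv_near => c; have C1 := basic_ge1 bs.
have h1 : `|comb n c t - comb n c u| <= (2 * K)^-1 * `|comb n c s|.
  apply: comb_perturb bs _ _; first by rewrite invr_ge0; lra.
  move=> i /h; have -> // : (2 * K)^-1 / (2 * C) = (4 * C * K)^-1 :> R.
  by field; lra.
apply: le_trans h1 _; have [_ h2] := us c.
rewrite invfM -mulrA; apply: ler_wpM2l; first lra.
by rewrite ler_pdivrMl.
Qed.

Definition blocks (p : nat -> nat) (g : nat -> nat -> R) x s :=
  [/\ forall n, (p n < p n.+1)%N,
      forall n i, (i < p n)%N || (p n.+1 <= i)%N -> g n i = 0 &
      forall n, x n = comb (p n.+1) (g n) s].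

Lemma blocks_mono p g x s : blocks p g x s ->
  forall n m, (n <= m)%N -> (p n <= p m)%N.
Proof.
move=> [hp _ _] n m; elim: m => [|m IH]; first by rewrite leqn0 => /eqP->.
rewrite leq_eqVlt => /predU1P[->//|/IH h]; exact: leq_trans h (ltnW (hp m)).
Qed.

Lemma blocks_ge p g x s : blocks p g x s -> forall n, (n <= p n)%N.
Proof. by move=> [hp _ _]; elim=> // n IH; apply: leq_ltn_trans (hp n). Qed.

(** Since [k <= p k], only rows [k <= i] reach coordinate [i]. Hence one [d] serves all [n], which
    is what bounds projections of blocks by projections of [s]. *)
Lemma comb_blocks p g x s c : blocks p g x s ->
  exists d, forall n, comb n c x = comb (p n) d s.
Proof.
move=> bl; have mono := blocks_mono bl; have ge := blocks_ge bl.
have [hp hg hx] := bl.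
exists (fun i => \sum_(k < i.+1) c k * g k i) => n.
rewrite (@eq_comb _ _ n c c x (fun k => comb (p n) (g k) s)); last first.
  move=> i lt_in; split=> //; rewrite hx (comb_wide _ _ (mono i.+1 n lt_in)).
  apply: eq_comb => j _; split=> //; case: ltnP => // h.
  by rewrite hg ?h ?orbT.
rewrite comb_sumr; apply: eq_comb => i lt_i; split=> //.
pose N := maxn n i.+1.
have aux m : (m <= N)%N -> (forall k, (m <= k)%N -> g k i = 0) ->
    \sum_(k < m) c k * g k i = \sum_(k < N) c k * g k i.
  move=> le_mN h; rewrite (big_ord_widen N (fun k => c k * g k i) le_mN) big_mkcond /=.
  by apply: eq_bigr => k _; case: ltnP => // /h ->; rewrite mulr0.
rewrite (aux n) ?leq_maxl //; last first.
  by move=> k /mono le_k; rewrite hg // (leq_trans lt_i).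
rewrite (aux i.+1) ?leq_maxr // => k lt_k; rewrite hg //.
by rewrite (leq_trans lt_k) ?ge.
Qed.

Lemma blocks_basic C p g x s : basic C s -> blocks p g x s -> (forall i, x i != 0) -> basic C x.
Proof.
move=> [_ bs] bl x0; split=> // n m c le_nm; have [d hd] := comb_blocks c bl.
by rewrite !hd; apply: bs; apply: (blocks_mono bl).
Qed.

Lemma block_basis_blocks x s : block_basis x s -> exists p g, blocks p g x s.
Proof.
move=> [p [c [hp hx]]]; exists p, (fun n i => if (p n <= i < p n.+1)%N then c i else 0).
split=> // [n i|n].
  by case/orP=> h; [rewrite leqNgt h|rewrite [(i < _)%N]ltnNge h andbF].
have [_ ->] := hx n; rewrite /comb.
rewrite (big_nat_widenl _ 0%N) // big_mkord big_mkcond; apply: eq_bigr => i _ /=.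
by rewrite ltn_ord andbT; case: ifP => // _; rewrite scale0r.
Qed.

Lemma bs_blocks s z : bs z ->
  blocks (fun n => if n is k.+1 then size (z k) else 0%N) (fun n i => ratr (z n)`_i)
    (fun n => ev s (z n)) s.
Proof.
move=> bz; split=> [[|n]|n i|n].
- exact: bs_size_gt.
- exact: bs_size.
- case/orP => h; last by rewrite nth_default // rmorph0.
  by case: n h => // n h; rewrite (bs_lo bz (ltnSn n)) // rmorph0.
- exact: ev_wide.
Qed.

Lemma bs_basic C s z : basic C s -> bs z -> basic C (fun n => ev s (z n)).
Proof.
move=> b bz; apply: (blocks_basic b (bs_blocks s bz)) => i.
by apply: (ev_neq0 b); have [] := bz i.
Qed.

Lemma bs_block_basis C s z : basic C s -> bs z -> block_basis (fun n => ev s (z n)) s.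
Proof.
move=> b bz; have [hp hg hx] := bs_blocks s bz.
exists (fun n => if n is k.+1 then size (z k) else 0%N), (fun i => \sum_(k < i.+1) ratr (z k)`_i).
split=> // n; split; first by apply: (ev_neq0 b); have [] := bz n.
rewrite hx (big_nat_widenl _ 0%N) // big_mkord big_mkcond; apply: eq_bigr => i _ /=.
set P := (fun n => _) in hp hg hx *; case: ifP => [le_i|/negbT]; last first.
  by rewrite -ltnNge => lt_i; rewrite (hg n i) ?lt_i ?scale0r.
have le_ni : (n <= i)%N by apply: leq_trans le_i; apply: (blocks_ge (bs_blocks s bz)).
congr (_ *: _); rewrite (bigD1 (Ordinal (le_ni : (n < i.+1)%N))) //= big1 ?addr0 // => k /eqP ne.
have [lt_kn|lt_nk|ekn] := ltngtP k n.
- apply: hg; apply/orP; right; apply: leq_trans le_i.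
  exact: (blocks_mono (bs_blocks s bz) lt_kn).
- apply: hg; rewrite (leq_trans (ltn_ord i)) //.
  exact: (blocks_mono (bs_blocks s bz) lt_nk).
- by case: ne; apply: val_inj.
Qed.

(** Zero coefficients stay exactly zero, so supports, and avoidance of removed intervals, survive
    the approximation. *)
Lemma rat_approx s N c (eps : R) : 0 < eps -> exists p : V,
  [/\ (size p <= N)%N, forall i, c i = 0 -> p`_i = 0 & `|comb N c s - ev s p| < eps].
Proof.
move=> eps0; pose B := \sum_(i < N) `|s i| + 1.
have B0 : 0 < B by rewrite ltr_wpDl // sumr_ge0.
have H i : exists q : rat, (c i = 0 -> q = 0) /\ `|c i - ratr q| < eps / B.
  have [->|nc] := eqVneq (c i) 0.
    by exists 0; rewrite rmorph0 subrr normr0 divr_gt0.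
  have [|q] := @rat_in_itvoo R (c i - eps / B) (c i + eps / B).
    by have := divr_gt0 eps0 B0; lra.
  rewrite in_itv /= => hq; exists q; split=> [/eqP|]; first by rewrite (negbTE nc).
  by rewrite ltr_norml; apply/andP; split; lra.
have [q hq] := choice H.
exists (\poly_(i < N) q i); split; first exact: size_poly.
  by move=> i ci; rewrite coef_poly (hq i).1 // if_same.
rewrite (ev_wide s (size_poly _ _)).
have -> : comb N c s - comb N (fun i => ratr (\poly_(i < N) q i)`_i) s =
    \sum_(i < N) (c i - ratr (q i)) *: s i.
  by rewrite /comb -sumrB; apply: eq_bigr => i _; rewrite coef_poly ltn_ord scalerBl.
apply: le_lt_trans (ler_norm_sum _ _ _) _.
apply: (@le_lt_trans _ _ (\sum_(i < N) eps / B * `|s i|)).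
  by apply: ler_sum => i _; rewrite normrZ ler_wpM2r // ltW // (hq i).2.
rewrite -mulr_sumr mulrAC ltr_pdivrMr // ltr_pM2l // /B ltrDl //.
Qed.

End Basic.

Lemma size_sub z (p : V) k : bs z -> (size p <= k.+1)%N -> (size (sub z p) <= size (z k))%N.
Proof.
move=> bz hp; apply: (leq_trans (size_sum _ _ _)); apply/bigmax_leqP => i _; apply: leq_trans (size_scale_leq _ _) _.
by apply: bs_size_mono => //; rewrite -ltnS (leq_trans (ltn_ord i)).
Qed.

(** * Approximation by rational blocks and transfer *)

Section Approx.
Variables (R : realType) (W : normedModType R) (e : nat -> W) (C : R).
Hypothesis be : basic C e.

Lemma approx_block z y (eta : nat -> R) : bs z -> block_basis y (fun n => ev e (z n)) ->
  (forall i, 0 < eta i) ->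
  exists y', [/\ bs y', forall i, sp z i (y' i) & forall i, `|ev e (y' i) - y i| <= eta i].
Proof.
move=> bz by_ eta0; have [p [g bl]] := block_basis_blocks by_.
have y0 i : y i != 0 by have [p' [c [_ /(_ i)[]]]] := by_.
have [hp hg hy] := bl; have ge := blocks_ge bl.
(* An error below [|y n|] keeps the rational block nonzero. *)
have H n : exists q : V, [/\ (size q <= p n.+1)%N, forall i, (i < p n)%N -> q`_i = 0 &
    `|y n - ev e (sub z q)| < Num.min (eta n) `|y n|].
  have [|q [q1 q2 q3]] := rat_approx (fun n => ev e (z n)) (p n.+1) (g n) (eps := Num.min (eta n) `|y n|).
    by rewrite lt_min eta0 normr_gt0 y0.
  exists q; split=> // [i lt_i|]; first by apply: q2; rewrite hg ?lt_i.
  by rewrite ev_sub {1}hy.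
have [q hq] := choice H.
have spy n : sp z (p n) (sub z (q n)) by exists (q n); have [_ ? _] := hq n.
exists (fun n => sub z (q n)); split=> [n|i|i].
- have [q1 q2 q3] := hq n; split.
    by apply/negP => /eqP s0; move: q3; rewrite s0 ev0 subr0 lt_min ltxx andbF.
  have [k ek] : exists k, p n.+1 = k.+1.
    by exists (p n.+1).-1; rewrite prednK // (leq_trans _ (ge n.+1)).
  rewrite ek in q1 => i lt_i; have := spy n.+1; rewrite ek => /(sp_lo bz); apply.
  exact: leq_trans lt_i (size_sub bz q1).
- exact: sp_mono (ge i) _ (spy i).
- have [_ _] := hq i; rewrite lt_min => /andP[/ltW + _]; by rewrite distrC.
Qed.

Lemma eqv_finite (s t : nat -> W) C' n : basic C s -> basic C' t ->
  exists K : nat, (0 < K)%N /\ eqv K%:R n s t.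
Proof.
have half C1 C2 (s1 s2 : nat -> W) : basic C1 s1 -> basic C2 s2 ->
    exists K : R, forall c, `|comb n c s1| <= K * `|comb n c s2|.
  move=> b1 b2; exists (\sum_(i < n) `|s1 i| / `|s2 i| * (2 * C2)) => c.
  apply: le_trans (ler_norm_sum _ _ _) _; rewrite mulr_suml; apply: ler_sum => i _.
  have h := basic_coef c (basic_ge1 b2) b2 (ltn_ord i).
  have s20 : 0 < `|s2 i| by rewrite normr_gt0 (proj1 b2).
  have {}h : `|c i| <= `|s2 i|^-1 * (2 * C2 * `|comb n c s2|) by rewrite ler_pdivlMl // mulrC.
  by rewrite normrZ [leLHS]mulrC -!mulrA ler_wpM2l // (le_trans h) // -!mulrA.
move=> b1 b2; have [K1 h1] := half _ _ _ _ b1 b2; have [K2 h2] := half _ _ _ _ b2 b1.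
have := @archi_boundP R (`|K1| + `|K2|) (addr_ge0 (normr_ge0 _) (normr_ge0 _)).
move: (Num.Def.archi_bound _) => K hK; exists K.+1; split=> // c.
have := ler_norm K1; have := ler_norm K2; have := normr_ge0 K1; have := normr_ge0 K2.
have hK' : K%:R <= K.+1%:R :> R by rewrite ler_nat.
split; [apply: le_trans (h1 c) _|apply: le_trans (h2 c) _]; apply: ler_wpM2r => //; lra.
Qed.

Lemma basic_split (s : nat -> W) m n c d : basic C s ->
  `|comb m c s| <= C * `|comb m c s + comb n d (fun i => s (m + i)%N)|.
Proof.
move=> [_ bs]; pose c' i := if (i < m)%N then c i else d (i - m)%N.
have -> : comb m c s = comb m c' s by apply: eq_comb => i lt_i; rewrite /c' lt_i.
have -> : comb n d (fun i => s (m + i)%N) = comb n (fun i => c' (m + i)%N) (fun i => s (m + i)%N).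
  by apply: eq_comb => i _; rewrite /c' ltnNge leq_addr /= addKn.
by rewrite -comb_cat; apply: bs; apply: leq_addr.
Qed.

(** Projecting a sum to its first part costs [C], to its second part [1 + C]. *)
Lemma eqv_cat K1 K2 m n (s t s' t' : nat -> W) :
  0 <= K1 -> 0 <= K2 -> eqv K1 m s t -> eqv K2 n s' t' ->
  (forall c d, `|comb m c s| <= C * `|comb m c s + comb n d s'|) ->
  (forall c d, `|comb m c t| <= C * `|comb m c t + comb n d t'|) ->
  eqv (C * K1 + (1 + C) * K2) (m + n) (fun i => if (i < m)%N then s i else s' (i - m)%N)
    (fun i => if (i < m)%N then t i else t' (i - m)%N).
Proof.
have C1 := basic_ge1 be; move=> K10 K20 h1 h2 hs ht.
have E (a b : nat -> W) c : comb (m + n) c (fun i => if (i < m)%N then a i else b (i - m)%N) =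
    comb m c a + comb n (fun i => c (m + i)%N) b.
  rewrite comb_cat; congr (_ + _); apply: eq_comb => i lt_i; first by rewrite lt_i.
  by rewrite ltnNge leq_addr /= addKn.
have aux (A B A' B' : W) : `|A| <= K1 * `|A'| -> `|B| <= K2 * `|B'| ->
    `|A'| <= C * `|A' + B'| -> `|A + B| <= (C * K1 + (1 + C) * K2) * `|A' + B'|.
  move=> a1 a2 a3; apply: le_trans (ler_normD _ _) _.
  have a4 : `|B'| <= (1 + C) * `|A' + B'|.
    have := ler_normB (A' + B') A'; rewrite addrC addKr; lra.
  have a5 := ler_wpM2l K10 a3; have a6 := ler_wpM2l K20 a4.
  by rewrite mulrDl -!mulrA (mulrCA C) (mulrCA (1 + C)); apply: lerD;
    [apply: le_trans a1 _|apply: le_trans a2 _].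
move=> c; rewrite !E; have [p1 p2] := h1 c; have [q1 q2] := h2 (fun i => c (m + i)%N).
by split; apply: aux.
Qed.

Section Embed.
Variables (N : nat -> V) (u : nat -> W) (Y : set W).
Hypotheses (hY : lin_subspace Y) (uY : forall i, Y (u i))
  (uN : forall n, eqv 2 n u (fun i => ev e (N i))).

Lemma lin_subspace_comb n c (s : nat -> W) : (forall i, (i < n)%N -> Y (s i)) -> Y (comb n c s).
Proof.
have [Y0 [YD YZ]] := hY; move=> h; rewrite /comb; elim/big_ind: _ => // i _.
by apply: YZ; apply: h.
Qed.

(** The game is played in the rational span of [N]; writing the vectors over [N] and substituting
    [u] carries every play into [Y]. *)
Lemma transfer : exists th : V -> W, (forall v, sp N 0 v -> Y (th v)) /\
  forall k (r : nat -> V), (forall i, (i < k)%N -> sp N 0 (r i)) ->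
    eqv 2 k (fun i => th (r i)) (fun i => ev e (r i)).
Proof.
have H v : exists p, sp N 0 v -> v = sub N p.
  have [[p [_ ep]]|h] := pselect (sp N 0 v); first by exists p.
  by exists 0 => /h.
have [p hp] := choice H.
exists (fun v => ev u (p v)); split=> [v _|k r hr].
  by rewrite /ev; apply: (lin_subspace_comb (fun i => ratr (p v)`_i)).
pose n := (\max_(i < k) size (p (r i)))%N.
have hn i : (i < k)%N -> (size (p (r i)) <= n)%N.
  by move=> lt_i; apply: (leq_bigmax (Ordinal lt_i)).
apply: (eq_eqv _ (eqv_ev hn (uN n))) => i lt_i; split=> //.
by rewrite {2}(hp _ (hr _ lt_i)) ev_sub.
Qed.
End Embed.
End Approx.

Lemma seq_equiv_eqv (R : realType) (W : normedModType R) (K : R) (s : seq W) (y : nat -> W) :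
  0 < K -> seq_equiv K s y <-> eqv K (size s) (nth 0 s) y.
Proof.
move=> K0; split=> h c; have := h c; rewrite -/(comb _ c (nth 0 s)) -/(comb _ c y).
  by rewrite ler_pdivrMl // => /andP[h1 h2].
by rewrite ler_pdivrMl // => -[-> ->].
Qed.

(** * Ranks of embedding trees *)

Section Rank.
Variables (R : realType) (W : normedModType R) (e : nat -> W) (C : R).
Hypothesis be : basic C e.

(** Repairs the loss of finitely many terms: the first [m] terms of [z] go to those of [N], and the
    basis constant glues head and tail. *)
Lemma WT_tail (O : Type) (lt : O -> O -> Prop) z N K m x :
  bs z -> bs N ->
  WT e lt (fun i => z (m + i)%N) (sp (fun i => N (m + i)%N) 0) K x [::] ->
  exists K', (0 < K')%N /\ WT e lt z (sp N 0) K' x (mkseq N m).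
Proof.
move=> bz bN h; have bez := bs_basic be bz; have beN := bs_basic be bN.
have C1 := basic_ge1 be.
have [K1 [K1_gt0 eK1]] := eqv_finite m beN bez.
have := @archi_boundP R (C * K1%:R + (1 + C) * K%:R).
move: (Num.Def.archi_bound _) => K2 hK2.
have {}hK2 : C * K1%:R + (1 + C) * K%:R <= K2.+1%:R.
  apply: ltW; apply: lt_le_trans (hK2 _) _; last by rewrite ler_nat.
  by rewrite addr_ge0 // mulr_ge0 // ?ler0n //; lra.
exists K2.+1; split=> //.
pose S x (v : seq V) := exists v', [/\ v = mkseq N m ++ v', forall w, w \in v' -> sp (fun i => N (m + i)%N) 0 w &
   WT e lt (fun i => z (m + i)%N) (sp (fun i => N (m + i)%N) 0) K x v'].
exists S; split; first by exists [::]; rewrite cats0.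
move=> {h} {}x _ [v' [-> hv' hx]]; have [h1 h2] := WT_step hx; split; last first.
  move=> x' /h2[w [hw w2]]; exists w; split.
    have [p [_ ->]] := hw; apply: sp_sub => i _ _; exact: sp_gen.
  exists (rcons v' w); rewrite rcons_cat; split=> // w'.
  by rewrite mem_rcons inE => /predU1P[->|/hv'].
have H1 := eqv_cat be (ler0n _ K1) (ler0n _ K) eK1 h1.
have {H1} := H1 _ (fun c d => @basic_split _ _ C _ _ _ c d bez) => H1.
rewrite size_cat size_mkseq; apply: eqv_mono hK2 _; apply: (eq_eqv _ (H1 _)).
  move=> i lt_i /=; rewrite nth_cat size_mkseq; case: ltnP => h; first by rewrite nth_mkseq.
  by rewrite subnKC.
move=> c d.
have H i : exists p : V, (i < size v')%N -> nth 0 v' i = sub (fun i => N (m + i)%N) p.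
  case: (ltnP i (size v')) => lt_i; last by exists 0.
  by have [p [_ ep]] := hv' _ (mem_nth 0 lt_i); exists p.
have [p hp] := choice H.
pose n := (\max_(i < size v') size (p i))%N.
have hn i : (i < size v')%N -> (size (p i) <= n)%N.
  by move=> lt_i; apply: (leq_bigmax (Ordinal lt_i)).
have -> : comb (size v') d (fun i => ev e (nth 0 v' i)) =
    comb (size v') d (fun i => ev (fun j => ev e (N (m + j)%N)) (p i)).
  by apply: eq_comb => i lt_i; rewrite hp // ev_sub.
by rewrite (comb_ev _ _ hn); apply: basic_split beN.
Qed.

Lemma WT_not_rank_le (O : Type) (lt : O -> O -> Prop) z N K x v Y u (y : nat -> W) :
  well_founded lt -> (0 < K)%N ->
  lin_subspace Y -> (forall i, Y (u i)) -> (forall n, eqv 2 n u (fun i => ev e (N i))) ->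
  (forall n, eqv 2 n (fun i => ev e (z i)) y) ->
  (forall w, w \in v -> sp N 0 w) -> WT e lt z (sp N 0) K x v ->
  ~ rank_le (emb_tree y Y (2 * K%:R * 2)) lt (fun o => lt o x).
Proof.
move=> wf K0 hY uY uN zy hv hx [f [f1 f2]].
have K0' : 0 < K%:R :> R by rewrite ltr0n.
have [th [th1 th2]] := transfer hY uY uN.
have inT x' v' : (forall w, w \in v' -> sp N 0 w) -> WT e lt z (sp N 0) K x' v' ->
    emb_tree y Y (2 * K%:R * 2) (map th v').
  move=> hv' hx'; have [h1 _] := WT_step hx'; split=> [i|].
    by rewrite size_map => lt_i; rewrite (nth_map 0) //; apply: th1; apply: hv'; rewrite mem_nth.
  apply/seq_equiv_eqv; first by rewrite !mulr_gt0.
  rewrite size_map; apply: eqv_trans (zy _); rewrite ?mulr_ge0 // ?ltW //.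
  have h3 : eqv 2 (size v') (nth 0 (map th v')) (fun i => ev e (nth 0 v' i)).
    have := th2 (size v') (nth 0 v'); move=> h; apply: (eq_eqv _ (h _)).
      by move=> i lt_i; rewrite (nth_map 0).
    by move=> i lt_i; apply: hv'; rewrite mem_nth.
  by apply: (eqv_trans _ _ h3 h1); rewrite // ltW.
(* If the value of [f] were below the clock, I could set the clock to that very value; the answer of
   II has a smaller value still, against induction. *)
suff : ~ lt (f (map th v)) x by apply; apply: f1; exact: inT hx.
elim/(well_founded_ind wf): x v hv hx {f1} => x IH v hv hx lx.
have [_ /(_ _ lx) [w [w1 w2]]] := WT_step hx.
have hv' w' : w' \in rcons v w -> sp N 0 w'.
  by rewrite mem_rcons inE => /predU1P[->//|/hv].
apply: (IH _ lx _ hv' w2); apply: f2; [exact: inT hx|exact: inT w2|].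
split; first by rewrite !size_map size_rcons.
by rewrite map_rcons size_map -cats1 take_cat size_map ltnn subnn take0 cats0.
Qed.

End Rank.

(** * Gliding humps in closed subspaces *)

Section Subspaces.
Variables (R : realType) (W : completeNormedModType R) (e : nat -> W)
  (cf : W -> nat -> R) (C : R).
Hypotheses (be : basic C e)
  (cfL : forall a x y i, cf (a *: x + y) i = a * cf x i + cf y i)
  (cfB : forall x n, `|comb n (cf x) e| <= C * `|x|)
  (cfE : forall n c i, cf (comb n c e) i = if (i < n)%N then c i else 0).

Lemma cf_vanish Y n : lin_subspace Y -> inf_dim Y ->
  exists u, [/\ Y u, `|u| = 1 & forall i, (i < n)%N -> cf u i = 0].
Proof.
move=> hY /(_ n.+1) [v [vY vi]].
pose M := \matrix_(i < n.+1, j < n) cf (v i) j.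
have kM : kermx M != 0.
  rewrite -mxrank_eq0 mxrank_ker -lt0n subn_gt0 ltnS; exact: rank_leq_col.
pose a := nz_row (kermx M).
have aM : a *m M = 0 by apply/sub_kermxP; exact: nz_row_sub.
have a0 : a != 0 by rewrite nz_row_eq0.
pose u := \sum_i a 0 i *: v i.
have Yu : Y u by have [Y0 [YD YZ]] := hY; rewrite /u; elim/big_ind: _ => // i _; exact: YZ.
have u0 : u != 0.
  apply: contra a0 => /eqP /vi h; apply/eqP/rowP => i; by rewrite h mxE.
have cf0 i : cf 0 i = 0.
  have := cfL 1 0 0 i; rewrite scale1r addr0 mul1r => /eqP.
  by rewrite -subr_eq subrr eq_sym => /eqP.
have cfu j : (j < n)%N -> cf u j = 0.
  move=> lt_j; have := congr1 (fun A : 'M[R]_(1, n) => A 0 (Ordinal lt_j)) aM.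
  rewrite !mxE => <-; rewrite /u.
  have -> : cf (\sum_i a 0 i *: v i) j = \sum_i a 0 i * cf (v i) j.
    by elim/big_rec2: _ => [|i p q _ <-]; rewrite ?cf0 ?cfL.
  by apply: eq_bigr => i _; rewrite mxE.
exists (`|u|^-1 *: u + 0); split.
- by have [Y0 [YD YZ]] := hY; apply: YD => //; apply: YZ.
- by rewrite addr0 normrZ normfV normr_id mulVf // normr_eq0.
- by move=> i lt_i; rewrite cfL cfu // cf0 mulr0 addr0.
Qed.

Lemma subspace_vector z Y k (eps : R) : bs z -> lin_subspace Y -> inf_dim Y ->
  Y `<=` cspan (fun i => ev e (z i)) setT -> 0 < eps ->
  exists u v, [/\ Y u, `|u| = 1, sp z k v & `|u - ev e v| < eps].
Proof.
move=> bz hY iY Yz eps0; have bl := bs_blocks e bz.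
have C1 := basic_ge1 be.
set x := (fun i => ev e (z i)) in Yz bl; set P := (fun n => _) in bl.
have [u [Yu u1 ucf]] := cf_vanish (P k) hY iY.
(* The approximation and the dropped part cost [d + C * d = eps / 2]; the rest is for rational
   coefficients. *)
pose d := eps / (2 * (1 + C)); have d0 : 0 < d by rewrite divr_gt0 //; lra.
have [_ [[N [a [_ ->]]] ua]] := (closureP _ _).1 (Yz _ Yu) d d0.
rewrite -/(comb N a x) in ua.
wlog le_kN : N a ua / (k <= N)%N.
  move=> H; apply: (H (maxn N k) (fun i => if (i < N)%N then a i else 0)); last exact: leq_maxr.
  by rewrite -comb_wide ?leq_maxl.
have [b hb] := comb_blocks a bl.
have small : `|comb k a x| <= C * d.
  have -> : comb k a x = comb (P k) (cf (-1 *: u + comb N a x)) e.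
    rewrite hb; apply: eq_comb => i lt_i; split=> //.
    by rewrite cfL ucf // mulr0 add0r hb cfE (leq_trans lt_i) // (blocks_mono bl le_kN).
  apply: le_trans (cfB _ _) _; rewrite scaleN1r addrC distrC ler_wpM2l //; [lra|exact: ltW].
pose a' i := if (i < k)%N then 0 else a i.
have ea : comb N a x = comb k a x + comb N a' x.
  rewrite (comb_wide _ _ le_kN) -combD; apply: eq_comb => i _; split=> //.
  by rewrite /a'; case: ifP; rewrite ?addr0 ?add0r.
have [p [p1 p2 p3]] := rat_approx x N a' (divr_gt0 eps0 (ltr0n _ 2)).
exists u, (sub z p); split=> //.
  by exists p; split=> // i lt_i; apply: p2; rewrite /a' lt_i.
rewrite ev_sub -/x.
have h1 := ler_normD (u - comb N a x) (comb k a x).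
have h2 := ler_normD (u - comb N a x + comb k a x) (comb N a' x - ev x p).
have e1 : u - comb N a x + comb k a x + (comb N a' x - ev x p) = u - ev x p.
  by rewrite -addrA (addrA (comb k a x)) -ea addrA subrK.
rewrite e1 in h2; apply: le_lt_trans h2 _.
have : d + C * d = eps / 2 by rewrite /d; field; lra.
lra.
Qed.

Lemma approx_subspace z Y : bs z -> lin_subspace Y -> inf_dim Y ->
  Y `<=` cspan (fun i => ev e (z i)) setT ->
  exists N u, [/\ bs N, forall i, sp z i (N i), forall i, Y (u i) &
    forall n, eqv 2 n u (fun i => ev e (N i))].
Proof.
move=> bz hY iY Yz; have C1 := basic_ge1 be.
(* Half of the [(4 * C)^-1] in [eqv_perturb], because [ev e (N i)] is only known to have norm at
   least 1/2. *)
pose eta i : R := (8 * C)^-1 * 2^-1 ^+ i.+1.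
have eta0 i : 0 < eta i by rewrite mulr_gt0 ?exprn_gt0 ?invr_gt0 //; lra.
have etal i : eta i <= 2^-1.
  have h1 : (8 * C)^-1 <= 1 :> R by rewrite invf_le1; lra.
  have h2 : 2^-1 ^+ i.+1 <= 2^-1 :> R by rewrite exprS ger_pMr ?exprn_ile1 //; lra.
  have h3 : 0 < 2^-1 ^+ i.+1 :> R by rewrite exprn_gt0.
  by rewrite /eta -[leRHS]mul1r ler_pM // ?invr_ge0; lra.
have [f hf] := choice (fun p : nat * nat =>
  subspace_vector p.1 bz hY iY Yz (eta0 p.2)).
have [g hg] := choice hf.
pose N := fix N i := if i is i'.+1 then g (maxn i (size (N i')), i) else g (0, 0)%N.
pose k i := if i is i'.+1 then maxn i (size (N i')) else 0%N.
have eN i : N i = g (k i, i) by case: i.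
have hN i : [/\ Y (f (k i, i)), `|f (k i, i)| = 1, sp z (k i) (N i) & `|f (k i, i) - ev e (N i)| < eta i].
  by rewrite eN; have := hg (k i, i).
have nN i : 2^-1 <= `|ev e (N i)|.
  have [_ h1 _ h2] := hN i; have := etal i.
  have := ler_normD (f (k i, i) - ev e (N i)) (ev e (N i)); rewrite subrK h1; lra.
exists N, (fun i => f (k i, i)); split.
- move=> n; split.
    by apply/negP => /eqP n0; have := nN n; rewrite n0 ev0 normr0; lra.
  move=> i lt_i; have [_ _ h _] := hN n.+1; apply: (sp_lo0 bz h).
  by rewrite (leq_trans lt_i) // leq_maxr.
- by move=> i; have [_ _ h _] := hN i; apply: sp_mono h; case: i => // i; exact: leq_maxl.
- by move=> i; have [] := hN i.
have bN : bs N.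
  move=> n; split.
    by apply/negP => /eqP n0; have := nN n; rewrite n0 ev0 normr0; lra.
  move=> i lt_i; have [_ _ h _] := hN n.+1; apply: (sp_lo0 bz h).
  by rewrite (leq_trans lt_i) // leq_maxr.
move=> n; apply: (eqv_perturb (bs_basic be bN)) => i _.
have [_ _ _ /ltW h] := hN i; apply: le_trans h _.
have e0 : 0 <= (4 * C)^-1 * 2^-1 ^+ i.+1 by rewrite mulr_ge0 ?exprn_ge0 ?invr_ge0 //; lra.
have := ler_wpM2l e0 (nN i); apply: le_trans; rewrite /eta.
rewrite le_eqVlt; apply/orP; left; apply/eqP; field; lra.
Qed.

End Subspaces.

Lemma infinite_branch (R : realType) (W : normedModType R) (e : nat -> W) z N K :
  WT e (fun _ _ : unit => True) z N K tt [::] ->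
  exists w, (forall i, N (w i)) /\ forall n, eqv K%:R n (fun i => ev e (w i)) (fun i => ev e (z i)).
Proof.
move=> h0.
have H (v : seq V) : exists w, WT e (fun _ _ : unit => True) z N K tt v ->
    N w /\ WT e (fun _ _ : unit => True) z N K tt (rcons v w).
  have [h|h] := pselect (WT e (fun _ _ : unit => True) z N K tt v); last by exists 0.
  by have [_ /(_ tt I)[w hw]] := WT_step h; exists w.
have [f hf] := choice H.
pose s := fix s k := if k is k'.+1 then rcons (s k') (f (s k')) else [::].
have hs k : WT e (fun _ _ : unit => True) z N K tt (s k).
  by elim: k => //= k /hf[].
have es k : s k = mkseq (fun i => f (s i)) k by elim: k => // k IH; rewrite mkseqS -IH.
exists (fun i => f (s i)); split=> [i|n]; first by have [] := hf _ (hs i).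
have [h _] := WT_step (hs n); rewrite es size_mkseq in h.
by apply: (eq_eqv _ h) => i lt_i; rewrite nth_mkseq.
Qed.

(** * Closed spans and isomorphic embeddings *)

Section Span.
Variables (R : realType) (W : completeNormedModType R).
Implicit Types (x t : nat -> W).

Lemma cspanP x v : cspan x setT v <->
  forall eps, 0 < eps -> exists n c, `|v - comb n c x| < eps.
Proof.
split=> [/closureP h eps /h [_ [[n [c [_ ->]]] hv]]|h]; first by exists n, c.
apply/closureP => eps /h [n [c hv]]; exists (comb n c x); split=> //.
by exists n, c; split=> // i; case.
Qed.

Lemma comb_diff x t K n m c d : 0 <= K -> (forall n, eqv K n t x) ->
  `|comb n c t - comb m d t| <= K * `|comb n c x - comb m d x|.
Proof.
move=> K0 h; pose N := maxn n m.
pose b i := (if (i < n)%N then c i else 0) + (-1) * (if (i < m)%N then d i else 0).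
have E s : comb n c s - comb m d s = comb N b s.
  by rewrite (comb_wide c _ (leq_maxl n m)) (comb_wide d _ (leq_maxr n m)) /b combD combZ scaleN1r.
by rewrite !E; have [] := h N b.
Qed.

(** [G] is the closure of the graph sending [x i] to [t i]. The two-sided estimate passes to it and
    makes it single-valued; completeness makes it total on the closed span. *)
Lemma extend_embedding x t K Y : 0 < K -> (forall n, eqv K n t x) ->
  closed Y -> lin_subspace Y -> (forall i, Y (t i)) -> iso_embeds (cspan x setT) Y.
Proof.
move=> K0 h cY hY tY; have K0' := ltW K0.
pose G v tau := forall eps, 0 < eps -> exists n c,
  `|v - comb n c x| < eps /\ `|tau - comb n c t| < eps.
have Glin a v w tau sg : G v tau -> G w sg -> G (a *: v + w) (a *: tau + sg).
  move=> Gv Gw eps eps0; pose d := eps / (`|a| + 1 + 1).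
  have a0 := normr_ge0 a.
  have d0 : 0 < d by rewrite divr_gt0 //; lra.
  have [n [c [c1 c2]]] := Gv _ d0; have [m [c' [c3 c4]]] := Gw _ d0.
  pose N := maxn n m.
  exists N, (fun i => a * (if (i < n)%N then c i else 0) + (if (i < m)%N then c' i else 0)).
  have E s : comb N (fun i => a * (if (i < n)%N then c i else 0) + (if (i < m)%N then c' i else 0)) s =
      a *: comb n c s + comb m c' s.
    by rewrite combD combZ -!comb_wide ?leq_maxl ?leq_maxr.
  have aux (p q p' q' : W) : `|p - p'| < d -> `|q - q'| < d ->
      `|a *: p + q - (a *: p' + q')| < eps.
    move=> h1 h2; rewrite opprD addrACA -scalerBr.
    apply: le_lt_trans (ler_normD _ _) _; rewrite normrZ.
    have -> : eps = `|a| * d + d + d by rewrite /d; field; lra.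
    have := ler_wpM2l a0 (ltW h1); lra.
  by rewrite !E; split; apply: aux.
have Gnorm v tau : G v tau -> `|tau| <= K * `|v| /\ `|v| <= K * `|tau|.
  move=> Gv; have aux (p q : W) (A : forall eps, 0 < eps -> exists p' q',
      [/\ `|p - p'| < eps, `|q - q'| < eps & `|q'| <= K * `|p'|]) : `|q| <= K * `|p|.
    apply: norm_le_eps => eps eps0; pose d := eps / (K + 1).
    have d0 : 0 < d by rewrite divr_gt0 //; lra.
    have [p' [q' [h1 h2 h3]]] := A _ d0.
    have := ler_normD (q - q') q'; rewrite subrK => h4.
    have := ler_normB p (p - p'); rewrite subKr => h5.
    have := ler_wpM2l K0' h5; have := ler_wpM2l K0' (ltW h1).
    have -> : eps = K * d + d by rewrite /d; field; lra.
    rewrite mulrDr; lra.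
  split; apply: aux => eps /Gv [n [c [c1 c2]]]; have [e1 e2] := h n c.
    by exists (comb n c x), (comb n c t).
  by exists (comb n c t), (comb n c x).
have ex v : cspan x setT v -> exists tau, G v tau.
  move=> /cspanP hv.
  have pw j : 0 < 2^-1 ^+ j :> R by rewrite exprn_gt0 // invr_gt0.
  have [n hn] := choice (fun k => hv _ (pw k)); have [c hc] := choice hn.
  have [|tau ht] := @geometric_cvg R W (fun k => comb (n k) (c k) t) (2 * K).
    move=> j m le_jm; apply: le_trans (comb_diff _ _ _ _ K0' h) _.
    rewrite [2 * K]mulrC -mulrA ler_pM2l //.
    have h1 := hc j; have h2 := hc m.
    have h3 : 2^-1 ^+ m <= 2^-1 ^+ j :> R by apply: ler_wiXn2l => //; lra.
    have := ler_normB (v - comb (n j) (c j) x) (v - comb (n m) (c m) x).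
    rewrite opprB addrC addrA subrK; lra.
  exists tau => eps eps0; have [j hj] := half_pow_lt (2 * K + 1) eps0.
  exists (n j), (c j); have h1 := hc j; have h2 := ht j; have := pw j => h3.
  have h4 : 0 < K * 2^-1 ^+ j by rewrite mulr_gt0.
  have E : (2 * K + 1) * 2^-1 ^+ j = 2 * K * 2^-1 ^+ j + 2^-1 ^+ j by ring.
  split; lra.
have H v : exists tau, cspan x setT v -> G v tau.
  by have [/ex[tau ?]|] := pselect (cspan x setT v); [exists tau|exists 0].
have [T hT] := choice H.
have uni v tau sg : G v tau -> G v sg -> tau = sg.
  move=> g1 g2; have := Glin (-1) _ _ _ _ g1 g2; rewrite !scaleN1r addNr => /Gnorm[+ _].
  by rewrite normr0 mulr0 normr_le0 addrC subr_eq0 => /eqP.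
exists T, K^-1, K; split; first by rewrite invr_gt0.
split=> //; split.
  move=> v /hT Gv; apply: cY; apply/closureP => eps /Gv [n [c [_ hc]]].
  by exists (comb n c t); split=> //; apply: lin_subspace_comb.
split.
  move=> a v w hv hw; apply: (uni (a *: v + w)); last exact: Glin (hT _ hv) (hT _ hw).
  apply: (hT); apply/cspanP => eps /(Glin a _ _ _ _ (hT _ hv) (hT _ hw)) [n [c [hc _]]].
  by exists n, c.
move=> v /hT /Gnorm [h1 h2]; rewrite h1 andbT ler_pdivrMl //.
Qed.

Lemma cspan_idc C x : basic C x -> idc_subspace setT (cspan x setT).
Proof.
move=> bx; split=> //; split; [split; [|split]|split].
- by apply/cspanP => eps eps0; exists 0%N, (fun=> 0); rewrite /comb big_ord0 subrr normr0.
- move=> u v /cspanP hu /cspanP hv; apply/cspanP => eps eps0.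
  have e2 : 0 < eps / 2 by rewrite divr_gt0.
  have [n [c hc]] := hu _ e2; have [m [d hd]] := hv _ e2.
  exists (maxn n m), (fun i => (if (i < n)%N then c i else 0) + (if (i < m)%N then d i else 0)).
  rewrite combD -!comb_wide ?leq_maxl ?leq_maxr // opprD addrACA.
  apply: le_lt_trans (ler_normD _ _) _; lra.
- move=> a u /cspanP hu; apply/cspanP => eps eps0.
  have a0 := normr_ge0 a.
  have e2 : 0 < eps / (`|a| + 1) by rewrite divr_gt0 //; lra.
  have [n [c hc]] := hu _ e2; exists n, (fun i => a * c i).
  rewrite combZ -scalerBr normrZ; apply: le_lt_trans (ler_wpM2l a0 (ltW hc)) _.
  rewrite mulrA ltr_pdivrMr; last lra.
  rewrite mulrDr mulr1 mulrC; lra.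
- exact: closed_closure.
- move=> n; exists (fun i => x i); split=> [i|a h i].
    apply/cspanP => eps eps0; exists i.+1, (fun j : nat => (j == i :> nat)%:R).
    rewrite /comb big_ord_recr /= eqxx scale1r big1 ?add0r ?subrr ?normr0 // => j _.
    by rewrite ltn_eqF // scale0r.
  pose c j := if insub j is Some k then a k else 0.
  have ec (k : 'I_n) : c k = a k by rewrite /c insubT //= => lt_k; congr a; apply: val_inj.
  have := basic_coef c (basic_ge1 bx) bx (ltn_ord i).
  have -> : comb n c x = 0 by rewrite -h /comb; apply: eq_bigr => j _; rewrite ec.
  rewrite normr0 mulr0 ec => h1.
  have h2 : 0 < `|x i| by rewrite normr_gt0 (proj1 bx).
  by apply/eqP; rewrite -normr_le0 -(pmulr_lle0 _ h2).
Qed.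

End Span.

Lemma minimal_of_branches (R : realType) (W : completeNormedModType R) (e : nat -> W)
  (cf : W -> nat -> R) (C : R) y K : basic C e ->
  (forall a x y i, cf (a *: x + y) i = a * cf x i + cf y i) ->
  (forall x n, `|comb n (cf x) e| <= C * `|x|) ->
  (forall n c i, cf (comb n c e) i = if (i < n)%N then c i else 0) ->
  bs y ->
  (forall N, bs N -> les N y -> WT e (fun _ _ : unit => True) y (sp N 0) K tt [::]) ->
  minimal_subspace (cspan (fun i => ev e (y i)) setT).
Proof.
move=> be cfL cfB cfE by_ h; split; first exact: cspan_idc (bs_basic be by_).
move=> Y [Yy [hY [cY iY]]].
have [N [u [bN Ny uY uN]]] := approx_subspace be cfL cfB cfE by_ hY iY Yy.
have lN : les N y.
  move=> n; exists n; apply: sp_min => i le_ni; exact: sp_mono le_ni _ (Ny i).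
have [w [wN we]] := infinite_branch (h N bN lN).
have [th [th1 th2]] := transfer hY uY uN.
(* The successor makes the constant positive. *)
apply: (@extend_embedding _ _ _ (fun i => th (w i)) (2 * K.+1%:R)) => //.
- move=> n; apply: (@eqv_mono _ _ (2 * K%:R)); first by rewrite ler_pM2l // ler_nat.
  by apply: (eqv_trans _ _ (th2 n w (fun i _ => wN i)) (we n)); rewrite // ler0n.
- by move=> i; apply: th1.
Qed.

(** * Moving a finite-dimensional span far out *)

Section Shift.
Variables (R : realType) (W : normedModType R) (e : nat -> W) (C : R).
Hypothesis be : basic C e.

Lemma basic_split_ev (s : nat -> W) D n c d (b : nat -> V) : basic C s ->
  (forall k, (k < n)%N -> forall i, (i < D)%N -> (b k)`_i = 0) ->
  `|comb D c s| <= C * `|comb D c s + comb n d (fun k => ev s (b k))|.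
Proof.
move=> [_ bs] hb; pose M := (\max_(k < n) size (b k))%N.
have hM k : (k < n)%N -> (size (b k) <= M)%N.
  by move=> lt_k; apply: (leq_bigmax (Ordinal lt_k)).
rewrite (comb_ev _ _ hM); set d' := fun j => _.
have d'0 j : (j < D)%N -> d' j = 0.
  by move=> lt_j; rewrite /d' big1 // => k _; rewrite hb // rmorph0 mulr0.
pose c1 i := if (i < D)%N then c i else if (i < M)%N then d' i else 0.
have -> : comb D c s = comb D c1 s by apply: eq_comb => i lt_i; rewrite /c1 lt_i.
have -> : comb D c1 s + comb M d' s = comb (maxn D M) c1 s.
  rewrite (comb_wide c1 _ (leq_maxl D M)) (comb_wide d' _ (leq_maxr D M)) -combD.
  apply: eq_comb => i _; split=> //; rewrite /c1; case: ltnP => h.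
    by case: ifP => _; rewrite ?d'0 ?addr0.
  by rewrite add0r.
by apply: bs; exact: leq_maxl.
Qed.

Lemma comb_shift n D c (s : nat -> W) :
  comb (n + D) (fun j => if (j < n)%N then 0 else c (j - n)%N) s = comb D c (fun i => s (n + i)%N).
Proof.
rewrite comb_cat [X in X + _](_ : _ = 0) ?add0r; last first.
  by rewrite /comb big1 // => i _; rewrite ltn_ord scale0r.
by apply: eq_comb => i _; rewrite ltnNge leq_addr /= addKn.
Qed.

Lemma rat_normalize (x : W) : x != 0 -> exists q : rat, 1 <= `|ratr q *: x| <= 2.
Proof.
move=> x0; have n0 : 0 < `|x| by rewrite normr_gt0.
have [|q] := @rat_in_itvoo R `|x|^-1 (2 / `|x|).
  by rewrite -[ltLHS]mul1r ltr_pM2r ?invr_gt0 //; lra.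
rewrite in_itv /= => /andP[h1 h2]; exists q.
have q0 : 0 < ratr q :> R by apply: lt_trans h1; rewrite invr_gt0.
rewrite normrZ gtr0_norm //; apply/andP; split.
  by rewrite -ler_pdivrMr // mul1r ltW.
by rewrite -ler_pdivlMr // ltW.
Qed.

(** Substituting it moves the first [D] coordinates onto [E] and fixes all higher ones. *)
Definition shift_seq D (E : seq V) i : V := if (i < D)%N then E`_i else 'X^i.

Lemma sub_shift_hi D E (p : V) : (forall i, (i < D)%N -> p`_i = 0) ->
  sub (shift_seq D E) p = p.
Proof.
move=> h; rewrite -[RHS]sub_X; apply: eq_bigr => i _; rewrite /shift_seq.
by case: ifP => // lt_i; rewrite h // !scale0r.
Qed.

Lemma sub_shift_lo D E (p : V) : (size p <= D)%N -> sub (shift_seq D E) p = sub (nth 0 E) p.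
Proof. by move=> h; apply: eq_sub => i lt_i; rewrite /shift_seq (leq_trans lt_i). Qed.

Definition split_at (z : nat -> V) D n1 : set V :=
  [set w | exists a b : V, [/\ (size a <= D)%N, sp z n1 b & w = a + b]].

(* The constant is independent of n and E: E_i has norm between 1 and 2. *)
Lemma eqv_shift z D : bs z -> exists K : nat, (0 < K)%N /\
  forall n (E v : seq V), size E = D ->
  (forall i, (i < D)%N -> exists q, E`_i = q *: z (n + i)%N /\ 1 <= `|ev e E`_i| <= 2) ->
  (forall w, w \in v -> split_at z D (n + D) w) ->
  eqv K%:R (size v) (fun i => ev e (nth 0 (map (sub (shift_seq D E)) v) i)) (fun i => ev e (nth 0 v i)).
Proof.
move=> bz; have C1 := basic_ge1 be; have bez := bs_basic be bz.
(* The two summands serve the two directions of the equivalence of [E] with the first [D] terms of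
   [e]; only norms between 1 and 2 enter. *)
pose Q : R := \sum_(i < D) (2 * `|e i|^-1 + `|e i|) * (2 * C).
have Q0 : 0 <= Q.
  by apply: sumr_ge0 => i _; rewrite mulr_ge0 ?addr_ge0 ?mulr_ge0 ?invr_ge0 //; lra.
have := @archi_boundP R (C * Q + (1 + C) * 1).
move: (Num.Def.archi_bound _) => K hK; exists K.+1; split=> // n E v sE hE hv.
have {}hK : C * Q + (1 + C) * 1 <= K.+1%:R.
  apply: ltW; apply: lt_le_trans (hK _) _; last by rewrite ler_nat.
  by rewrite addr_ge0 // mulr_ge0 //; lra.
have H i : exists ab : V * V, (i < size v)%N ->
    [/\ (size ab.1 <= D)%N, sp z (n + D) ab.2 & nth 0 v i = ab.1 + ab.2].
  case: (ltnP i (size v)) => lt_i; last by exists (0, 0).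
  by have [a [b h]] := hv _ (mem_nth 0 lt_i); exists (a, b).
have [ab hab] := choice H.
(* The vectors and their shifts share the coordinates [r]: the head over [e] or over [E], and slot
   [D + i] for the unmoved tail. *)
pose r i : V := (ab i).1 + 'X^(D + i)%N.
pose tl i : W := ev e (ab i).2.
pose s (h : nat -> W) (i : nat) := if (i < D)%N then h i else tl (i - D)%N.
have evs h i : (i < size v)%N -> ev (s h) (r i) = ev h (ab i).1 + tl i.
  move=> /hab[h1 _ _]; rewrite /r evD evXn /s ltnNge leq_addr /= addKn; congr (_ + _).
  by apply: eq_bigr => j _; rewrite (leq_trans (ltn_ord j) h1).
have hr i : (i < size v)%N -> (size (r i) <= D + size v)%N.
  move=> lt_i; have [h1 _ _] := hab i lt_i.
  rewrite (leq_trans (size_polyD _ _)) // geq_max size_polyXn -addnS leq_add2l lt_i andbT.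
  by rewrite (leq_trans h1) // leq_addr.
have lo k : (k < size v)%N -> forall i, (i < D)%N -> ((ab k).2)`_i = 0.
  move=> /hab[_ h _] i lt_i; apply: (sp_lo0 bz h).
  by rewrite (leq_trans lt_i) // leq_addl.
have sp1 c d : `|comb D c e| <= C * `|comb D c e + comb (size v) d tl|.
  exact: basic_split_ev be lo.
have ex2 : exists q : nat -> rat, forall i, (i < D)%N -> E`_i = q i *: z (n + i)%N.
  have H2 i : exists q, (i < D)%N -> E`_i = q *: z (n + i)%N.
    by case: (ltnP i D) => [/hE[q [-> _]]|_]; [exists q|exists 0].
  by have [q hq] := choice H2; exists q.
have [q hq] := ex2.
have combE c : comb D c (fun i => ev e E`_i) =
    comb (n + D) (fun j => if (j < n)%N then 0 else c (j - n)%N * ratr (q (j - n)%N)) (fun i => ev e (z i)).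
  rewrite (comb_shift _ _ (fun i => c i * ratr (q i))).
  by apply: eq_bigr => i _; rewrite hq // evZ scalerA.
have sp2' c d : `|comb (n + D) c (fun i => ev e (z i))| <= C * `|comb (n + D) c (fun i => ev e (z i)) + comb (size v) d tl|.
  have H3 k : exists p : V, (k < size v)%N -> (forall i, (i < n + D)%N -> p`_i = 0) /\ (ab k).2 = sub z p.
    case: (ltnP k (size v)) => [/hab[_ [p hp] _]|_]; [by exists p|by exists 0].
  have [p hp] := choice H3.
  have -> : comb (size v) d tl = comb (size v) d (fun k => ev (fun i => ev e (z i)) (p k)).
    by apply: eq_comb => k lt_k; rewrite /tl (hp k lt_k).2 ev_sub.
  by apply: basic_split_ev bez _ => k lt_k; exact: (hp k lt_k).1.
have sp2 c d : `|comb D c (fun i => ev e E`_i)| <= C * `|comb D c (fun i => ev e E`_i) + comb (size v) d tl|.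
  by rewrite combE; exact: sp2'.
have e0 i : 0 < `|e i| by rewrite normr_gt0 (proj1 be).
have e1 i : (i < D)%N -> 1 <= `|ev e E`_i| <= 2 by case/hE => ? [].
have crd c i : (i < D)%N -> `|c i| <= 2 * C * `|comb D c (fun i => ev e E`_i)|.
  move=> lt_i; apply: (@le_trans _ _ (`|c i| * `|ev e E`_i|)).
    by have /andP[h _] := e1 i lt_i; rewrite ler_peMr.
  have -> : `|c i| * `|ev e E`_i| = `|comb i.+1 c (fun i => ev e E`_i) - comb i c (fun i => ev e E`_i)|.
    by rewrite /comb big_ord_recr /= addrAC subrr add0r normrZ.
  have mono m : (m <= D)%N -> `|comb m c (fun i => ev e E`_i)| <= C * `|comb D c (fun i => ev e E`_i)|.
    move=> le_m; have -> : comb m c (fun i => ev e E`_i) =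
        comb (n + m) (fun j => if (j < n)%N then 0 else c (j - n)%N * ratr (q (j - n)%N)) (fun i => ev e (z i)).
      rewrite (comb_shift _ _ (fun i => c i * ratr (q i))).
      apply: eq_bigr => j _; rewrite hq ?evZ ?scalerA //.
      exact: leq_trans (ltn_ord j) le_m.
    by rewrite combE; apply: (proj2 bez); rewrite leq_add2l.
  apply: le_trans (ler_normB _ _) _; have := mono _ lt_i; have := mono _ (ltnW lt_i); lra.
have eqE : eqv Q D (fun i => ev e E`_i) e.
  move=> c; split; apply: le_trans (ler_norm_sum _ _ _) _; rewrite mulr_suml; apply: ler_sum => i _; rewrite normrZ.
    have h1 := basic_coef c C1 be (ltn_ord i); have /andP[_ h2] := e1 i (ltn_ord i).
    have h3 : `|c i| <= `|e i|^-1 * (2 * C * `|comb D c e|) by rewrite ler_pdivlMl // mulrC.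
    have h4 : 0 <= `|e i| * (2 * C * `|comb D c e|) by rewrite !mulr_ge0 //; lra.
    have h5 := ler_pM (normr_ge0 (c i)) (normr_ge0 _) h3 h2.
    have -> : (2 * `|e i|^-1 + `|e i|) * (2 * C) * `|comb D c e| =
       `|e i|^-1 * (2 * C * `|comb D c e|) * 2 + `|e i| * (2 * C * `|comb D c e|) by ring.
    lra.
  have h1 := crd c i (ltn_ord i).
  have h4 : 0 <= `|e i|^-1 * (2 * C * `|comb D c (fun i => ev e E`_i)|).
    by rewrite !mulr_ge0 ?invr_ge0 //; lra.
  have h5 := ler_wpM2r (ltW (e0 i)) h1.
  have -> : (2 * `|e i|^-1 + `|e i|) * (2 * C) * `|comb D c (fun i => ev e E`_i)| =
     2 * (`|e i|^-1 * (2 * C * `|comb D c (fun i => ev e E`_i)|)) +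
     2 * C * `|comb D c (fun i => ev e E`_i)| * `|e i| by ring.
  lra.
have big := eqv_cat be Q0 ler01 eqE (@eqv_refl _ _ (size v) tl) sp2 sp1.
apply: (eqv_mono hK); apply: (eq_eqv _ (eqv_ev hr big)) => i lt_i.
have [h1 h2 h3] := hab i lt_i.
rewrite -!/(s _) !evs // (nth_map 0) // h3; split; last by rewrite evD.
rewrite subD sub_shift_lo // sub_shift_hi; last exact: lo.
by rewrite evD ev_sub.
Qed.

(* The span of F0 is moved far out, into the region where II is allowed to play. *)
Lemma WF_shift (O : Type) (lt : O -> O -> Prop) y z K x F0 : bs z ->
  WF e lt y (sp z) K x [::] F0 -> exists K', WF e lt y (sp z) K' x [::] [::].
Proof.
move=> bz hx.
pose D := (\max_(f <- F0) size f)%N.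
have hD f : f \in F0 -> (size f <= D)%N.
  by move=> fF; apply: (@leq_bigmax_seq _ _ xpredT (fun f : V => size f)).
have [K1 [K10 hK1]] := eqv_shift D bz.
pose good n (E : seq V) := size E = D /\ forall i, (i < D)%N ->
  exists q, E`_i = q *: z (n + i)%N /\ 1 <= `|ev e E`_i| <= 2.
have exE n : exists E, good n E.
  have H i : exists q : rat, 1 <= `|ratr q *: ev e (z (n + i)%N)| <= 2.
    by apply: rat_normalize; apply: (ev_neq0 be); have [] := bz (n + i)%N.
  have [q hq] := choice H; exists (mkseq (fun i => q i *: z (n + i)%N) D).
  split=> [|i lt_i]; first by rewrite size_mkseq.
  by exists (q i); rewrite nth_mkseq // evZ.
have splitF n F1 w : (forall g, g \in F1 -> sp z (n + D) g) -> span (F0 ++ F1) w ->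
    split_at z D (n + D) w.
  move=> hF1 [p [hp ->]]; rewrite /sub; elim/big_rec: _ => [|i v _ [a [b [h1 h2 ->]]]].
    by exists 0, 0; rewrite size_poly0 addr0; split=> //; exact: sp0.
  have [a' [b' [h3 h4 ->]]] : split_at z D (n + D) (F0 ++ F1)`_i.
    have : (F0 ++ F1)`_i \in F0 ++ F1 by rewrite mem_nth // (leq_trans (ltn_ord i)).
    rewrite mem_cat => /orP[/hD h|/hF1 h].
      by exists (F0 ++ F1)`_i, 0; rewrite addr0; split=> //; exact: sp0.
    by exists 0, (F0 ++ F1)`_i; rewrite add0r size_poly0.
  exists (p`_i *: a' + a), (p`_i *: b' + b); split.
  - rewrite (leq_trans (size_polyD _ _)) // geq_max h1 andbT.
    by rewrite (leq_trans (size_scale_leq _ _)).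
  - by apply: spD h2; apply: spZ.
  - by rewrite scalerDr addrACA.
have spanT n E F1 w : good n E -> (forall g, g \in F1 -> sp z (n + D) g) ->
    span (F0 ++ F1) w -> span (E ++ F1) (sub (shift_seq D E) w).
  move=> [sE _] hF1 [p [hp ->]]; rewrite sub_sub.
  pose u := map (sub (shift_seq D E)) (F0 ++ F1).
  have -> : sub (fun i => sub (shift_seq D E) (F0 ++ F1)`_i) p = sub (nth 0 u) p.
    by apply: eq_sub => i lt_i; rewrite (nth_map 0) // (leq_trans lt_i).
  apply: span_sub; last by rewrite size_map.
  move=> w' /mapP[g]; rewrite mem_cat => /orP[/hD h|gF] ->.
    rewrite sub_shift_lo //; apply: span_catl; exists g; by rewrite sE.
  rewrite sub_shift_hi => [|i lt_i]; last first.
    by apply: (sp_lo0 bz (hF1 _ gF)); rewrite (leq_trans lt_i) // leq_addl.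
  exists 'X^(size E + index g F1)%N; rewrite size_polyXn size_cat -addnS leq_add2l index_mem gF.
  by rewrite subXn nth_cat ltnNge leq_addr /= addKn nth_index.
exists (K1 * K)%N.
(* The start is a separate case: [E] can be chosen only after I has played its first [n]. *)
pose S c (v' F' : seq V) := [/\ c = x, v' = [::] & F' = [::]] \/
  exists n E v F1, [/\ good n E, WF e lt y (sp z) K c v (F0 ++ F1),
    v' = map (sub (shift_seq D E)) v /\ F' = E ++ F1,
    forall g, g \in F1 -> sp z (n + D) g & forall w, w \in v -> span (F0 ++ F1) w].
exists S; split; first by left.
have memc (A B : seq V) n : (forall g, g \in A -> sp z n g) -> (forall g, g \in B -> sp z n g) ->
    forall g, g \in A ++ B -> sp z n g.
  by move=> hA hB g; rewrite mem_cat => /orP[/hA|/hB].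
move=> c v' F' [[-> -> ->]|[n [E [v [F1 [gE hc [-> ->] hF1 hv]]]]]].
  split; first exact: eqv0.
  move=> x' n lx; have [_ h2] := WF_step hx; have [E gE] := exE n.
  have [G [w [g1 g2 g3]]] := h2 x' (n + D)%N lx.
  exists (E ++ G), (sub (shift_seq D E) w); split.
  - apply: memc => g; last by move=> /g1; apply: sp_mono; exact: leq_addr.
    have [sE hE] := gE; case/(nthP 0) => i; rewrite sE => /hE[q [-> _]] <-.
    by apply: spZ; apply: sp_gen; exact: leq_addr.
  - exact: (spanT n E G w gE g1 g2).
  - right; exists n, E, [:: w], G; split=> // w'; rewrite inE => /eqP ->//.
have [h1 h2] := WF_step hc; split.
  rewrite natrM size_map; apply: (eqv_trans _ _ _ h1); rewrite ?ler0n //.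
  by have [sE hE] := gE; apply: (hK1 n) => // w /hv; exact: splitF.
move=> x' n' lx; have [G [w [g1 g2 g3]]] := h2 x' (maxn n' (n + D)) lx.
have gF : forall g, g \in F1 ++ G -> sp z (n + D) g.
  by apply: memc => // g /g1; apply: sp_mono; exact: leq_maxr.
exists G, (sub (shift_seq D E) w); split.
- by move=> g /g1; apply: sp_mono; exact: leq_maxl.
- by rewrite -catA; apply: (spanT n _ _ _ gE gF); rewrite catA.
- right; exists n, E, (rcons v w), (F1 ++ G); split=> //.
  + by rewrite catA.
  + by rewrite map_rcons catA.
  + by move=> w'; rewrite mem_rcons inE catA => /predU1P[->//|/hv]; exact: span_catl.
Qed.

End Shift.

Lemma omega_times_trans (O : Type) (lt : O -> O -> Prop) :
  (forall a b c, lt a b -> lt b c -> lt a c) ->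
  forall p q r, omega_times lt p q -> omega_times lt q r -> omega_times lt p r.
Proof.
move=> tr [p1 p2] [q1 q2] [r1 r2] [/= pq|/= [-> pq]] [/= qr|/= [<- qr]].
- by left; exact: tr qr.
- by left.
- by left.
- by right; split=> //; exact: ltn_trans qr.
Qed.

Lemma span_mem F (Z : nat -> V) (q : V) :
  (forall i, (i < size q)%N -> q`_i != 0 -> Z i \in F) -> span F (sub Z q).
Proof.
move=> h; rewrite /sub; elim/big_rec: _ => [|i v _ [p [hp ->]]].
  by exists 0; rewrite size_poly0 sub0.
have [->|nq] := eqVneq q`_i 0; first by exists p; rewrite scale0r add0r.
exists (q`_i *: 'X^(index (Z i) F) + p).
have iF : Z i \in F by exact: h.
rewrite subD subZ subXn nth_index //; split=> //.
rewrite (leq_trans (size_polyD _ _)) // geq_max hp andbT.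
by rewrite (leq_trans (size_scale_leq _ _)) // size_polyXn index_mem.
Qed.

(** * Tightness from the failure of II *)

Section Tight.
Variables (R : realType) (W : completeNormedModType R) (e : nat -> W) (C : R).
Hypothesis be : basic C e.
Variables (O : eqType) (lt : O -> O -> Prop) (al : O).
Hypothesis ltr : forall a b c, lt a b -> lt b c -> lt a c.
Local Notation olt := (omega_times lt).
Local Notation position := (nat * (O * nat) * seq V * seq V)%type.

(** Without such a refuting move the position could be added to the greatest fixpoint. *)
Lemma not_WF_step y Z K c v F : ~ WF e olt y Z K c v F ->
  eqv K%:R (size v) (fun i => ev e (nth 0 v i)) (fun i => ev e (y i)) ->
  exists c' n, olt c' c /\ forall G w, (forall g, g \in G -> Z n g) -> span (F ++ G) w ->
    ~ WF e olt y Z K c' (rcons v w) (F ++ G).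
Proof.
move=> nW hv; apply: contrapT => h; apply: nW.
pose S c' v' F' := (c' = c /\ v' = v /\ F' = F) \/ WF e olt y Z K c' v' F'.
exists S; split; first by left.
move=> c' v' F' [[-> [-> ->]]|hW]; last first.
  have [h1 h2] := WF_step hW; split=> // x n lx; have [G [w [g1 g2 g3]]] := h2 x n lx.
  by exists G, w; split=> //; right.
split=> // x n lx; apply: contrapT => h'; apply: h; exists x, n; split=> // G w hG hw hW.
by apply: h'; exists G, w; split=> //; right.
Qed.

(* The intervals of tightness: the j-th interval reaches beyond the answers of I in all
   the positions that can arise from vectors of code at most j supported outside the
   intervals chosen earlier. *)
Section Intervals.
Variables (Z : nat -> V) (nx : position -> (O * nat) * nat).

Definition seg m n : seq V := [seq Z i | i <- iota m (n - m)].

(** [bp.1] is the right end of one removed interval and [a] the left end of the next removed one.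
    All terms in between join the list, since the intervals there are kept. *)
Definition extend a (bp : nat * position) (w : V) : position :=
  let '(K, c, v, F) := bp.2 in (K, (nx bp.2).1, rcons v w, F ++ seg bp.1.+1 a).

Definition words j : seq V := pmap unpickle (iota 0 j.+1).

Definition stage_positions j a (acc : seq (nat * position)) : seq position :=
  [seq (K, (al, 0%N), [::], seg 0 a) | K <- iota 0 j.+1] ++
  [seq extend a bp w | bp <- acc, w <- words j].

Definition stage_bound j a acc :=
  maxn a (\max_(p <- stage_positions j a acc) (nx p).2)%N.

(* The first component is the left end of the j-th interval; the second lists the
   positions considered so far, each with the right end of its interval. *)
Fixpoint stage j : nat * seq (nat * position) :=
  if j is j'.+1 then
    let: (a, acc) := stage j' in
    let b := stage_bound j' a acc in
    (b.+1, acc ++ [seq (b, p) | p <- stage_positions j' a acc])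
  else (0%N, [::]).

Definition left_end j := (stage j).1.
Definition right_end j := stage_bound j (stage j).1 (stage j).2.
Definition occurs j p := p \in stage_positions j (stage j).1 (stage j).2.

Lemma stageS j : stage j.+1 = ((right_end j).+1,
  (stage j).2 ++ [seq (right_end j, p) | p <- stage_positions j (stage j).1 (stage j).2]).
Proof. by rewrite /= /right_end; case: (stage j). Qed.

Lemma left_endS j : left_end j.+1 = (right_end j).+1.
Proof. by rewrite /left_end stageS. Qed.

Lemma left_le_right j : (left_end j <= right_end j)%N.
Proof. exact: leq_maxl. Qed.

Lemma left_end_ge j : (j <= left_end j)%N.
Proof. by elim: j => // j IH; rewrite left_endS ltnS (leq_trans IH) // left_le_right. Qed.

Lemma occurs_bound j p : occurs j p -> ((nx p).2 <= right_end j)%N.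
Proof.
move=> h; rewrite /right_end /stage_bound (leq_trans _ (leq_maxr _ _)) //.
exact: (@leq_bigmax_seq _ _ xpredT (fun p => (nx p).2)).
Qed.

Lemma occurs_init j K : (K <= j)%N -> occurs j (K, (al, 0%N), [::], seg 0 (left_end j)).
Proof.
move=> le_Kj; rewrite /occurs mem_cat; apply/orP; left; apply/mapP; exists K => //.
by rewrite mem_iota.
Qed.

Lemma occurs_acc i j p : (i < j)%N -> occurs i p -> (right_end i, p) \in (stage j).2.
Proof.
elim: j => // j IH; rewrite ltnS leq_eqVlt stageS mem_cat => /predU1P[<-|lt_ij] h.
  by apply/orP; right; apply/mapP; exists p.
by rewrite IH.
Qed.

Lemma occurs_extend i j K c v F w : (i < j)%N -> occurs i (K, c, v, F) -> (pickle w <= j)%N ->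
  occurs j (K, (nx (K, c, v, F)).1, rcons v w, F ++ seg (right_end i).+1 (left_end j)).
Proof.
move=> lt_ij h le_w; rewrite /occurs mem_cat; apply/orP; right; apply/allpairsP.
exists ((right_end i, (K, c, v, F)), w); split=> //=; first exact: occurs_acc.
by rewrite mem_pmap; apply/mapP; exists (pickle w); rewrite ?pickleK // mem_iota.
Qed.

End Intervals.

Lemma emb_tree_prefix (y : nat -> W) Y K s x : 0 < K -> emb_tree y Y K (rcons s x) -> emb_tree y Y K s /\ Y x.
Proof.
move=> K0 [h1 /seq_equiv_eqv h2]; split; last first.
  by have := h1 (size s); rewrite size_rcons ltnSn nth_rcons ltnn eqxx; apply.
split=> [i lt_i|].
  by have := h1 i; rewrite size_rcons nth_rcons lt_i ltnS ltnW //; apply.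
apply/seq_equiv_eqv => //; have := h2 K0; rewrite size_rcons => h3.
apply: (eq_eqv _ (eqv_widen (leqnSn _) h3)) => i lt_i; by rewrite nth_rcons lt_i.
Qed.

(** Climbing a tree of embeddings is a play of II, with vectors replaced by nearby rational ones off
    the removed intervals. The clock answers of I descend strictly below [(al, 0)] and so rank the
    tree. *)
Lemma tight_of_not_WF Z : bs Z ->
  (forall y K, bs y -> les y Z -> ~ WF e olt y (sp Z) K (al, 0%N) [::] [::]) ->
  beta_tight (fun i => ev e (Z i))
    (omega_times (fun a b : {o | lt o al} => lt (sval a) (sval b))).
Proof.
move=> bZ nW y by_; have C1 := basic_ge1 be.
have beZ := bs_basic be bZ.
have bY : basic C y.
  have [p [g bl]] := block_basis_blocks by_; apply: (blocks_basic beZ bl) => i.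
  by have [p' [c [_ /(_ i)[]]]] := by_.
have [|y' [by' Zy' yy']] := approx_block (eta := fun i => (4 * C)^-1 * 2^-1 ^+ i.+1 * `|y i|) bZ by_.
  by move=> i; rewrite !mulr_gt0 ?exprn_gt0 ?invr_gt0 ?normr_gt0 ?(proj1 bY) //; lra.
have bY' := bs_basic be by'.
have yeq n : eqv 2 n (fun i => ev e (y' i)) y.
  by apply: (eqv_perturb bY) => i _; exact: yy'.
have lZ : les y' Z.
  by move=> n; exists n; apply: sp_min => i le_ni; exact: sp_mono le_ni _ (Zy' i).
(* [F] will be the list of terms before the first removed interval. *)
have lose0 K F : ~ WF e olt y' (sp Z) K (al, 0%N) [::] F.
  by move=> h; have [K' h'] := WF_shift be bZ h; exact: nW by' lZ h'.
have H (p : position) : exists cn : (O * nat) * nat, let '(K, c, v, F) := p in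
    ~ WF e olt y' (sp Z) K c v F ->
    eqv K%:R (size v) (fun i => ev e (nth 0 v i)) (fun i => ev e (y' i)) ->
    olt cn.1 c /\ forall G w, (forall g, g \in G -> sp Z cn.2 g) -> span (F ++ G) w ->
      ~ WF e olt y' (sp Z) K cn.1 (rcons v w) (F ++ G).
  case: p => [[[K c] v] F].
  have [[h1 h2]|h] := pselect (~ WF e olt y' (sp Z) K c v F /\
      eqv K%:R (size v) (fun i => ev e (nth 0 v i)) (fun i => ev e (y' i))).
    by have [c' [n hn]] := not_WF_step h1 h2; exists (c', n).
  by exists ((al, 0%N), 0%N) => h1 h2; case: h.
have [nx hnx] := choice H.
pose a := left_end Z nx; pose b := right_end Z nx.
exists a, b; split; first exact: left_le_right.
split=> [j|A infA K K1]; first by rewrite /a left_endS.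
pose off := [set n | ~ exists j, A j /\ (a j <= n <= b j)%N].
set Y := cspan _ _; pose T := emb_tree y Y K.
have K0 : 0 < K by lra.
(* A factor 2 for rational approximation of the node, [K] for the tree, and 2 for passing from [y]
   to [y']. *)
have K4 : 0 <= 2 * (K * 2) by lra.
have := archi_boundP K4.
move: (Num.Def.archi_bound _) => Kn /ltW hKn.
pose eta i : R := (4 * C * (K * 2))^-1 * 2^-1 ^+ i.+1 * `|ev e (y' i)|.
have eta0 i : 0 < eta i.
  by rewrite !mulr_gt0 ?exprn_gt0 ?invr_gt0 ?normr_gt0 ?(proj1 bY') // !mulr_gt0 //; lra.
(* The position follows the node [s] up to errors [eta], was foreseen at stage [j], and lists every
   remaining term before [a j]. *)
pose Inv (s : seq W) (jp : nat * position) := let '(j, (K', c, v, F)) := jp in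
  [/\ A j /\ occurs Z nx j (K', c, v, F), K' = Kn /\ (c = (al, 0%N) \/ olt c (al, 0%N)),
   ~ WF e olt y' (sp Z) K' c v F,
   size v = size s /\ forall i, (i < size s)%N -> `|ev e (nth 0 v i) - nth 0 s i| <= eta i &
   forall i, (i < a j)%N -> off i -> Z i \in F].
have memseg m n i : (m <= i < n)%N -> Z i \in seg Z m n.
  move=> h; apply/mapP; exists i => //; rewrite mem_iota; lia.
have invEqv s j K' c v F : T s -> Inv s (j, (K', c, v, F)) ->
    eqv K'%:R (size v) (fun i => ev e (nth 0 v i)) (fun i => ev e (y' i)).
  move=> [_ /(seq_equiv_eqv _ _ K0) Ts] [_ [-> _] _ [sv hv] _].
  apply: (eqv_mono hKn); rewrite sv.
  apply: (@eqv_perturb_trans _ _ C (K * 2) _ _ (nth 0 s)) => //; first lra.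
  by apply: eqv_trans Ts (eqv_sym (yeq _)); rewrite // ltW.
have step (q : seq W * (nat * position) * W) : exists jp', let '(s, jp, x) := q in
    Inv s jp -> T (rcons s x) ->
    [/\ Inv (rcons s x) jp', olt jp'.2.1.1.2 jp.2.1.1.2 & jp'.2.1.1.2 = (nx jp.2).1].
  case: q => [[s [j [[[K' c] v] F]]] x].
  have [[I0 Tx]|h] := pselect (Inv s (j, (K', c, v, F)) /\ T (rcons s x)); last first.
    by exists (0%N, (0%N, (al, 0%N), [::], [::])) => h1 h2; case: h.
  have [Ts Yx] := emb_tree_prefix K0 Tx.
  have Q := invEqv _ _ _ _ _ _ Ts I0.
  have [[Aj oj] [eK hc] nWp [sv hv] hF] := I0.
  have [lc hlose] := hnx (K', c, v, F) nWp Q.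
  have [_ [[N [d [hd ->]]] xd]] := (closureP _ _).1 Yx _ (divr_gt0 (eta0 (size s)) (ltr0n _ 2)).
  have [q [q1 q2 q3]] := rat_approx (fun i => ev e (Z i)) N d (divr_gt0 (eta0 (size s)) (ltr0n _ 2)).
  pose w := sub Z q.
  (* Beyond [j], so that new terms start after the bound of I; beyond the code of [w], so that the
     position is foreseen; beyond [size q], so that [w] is in the span of the list. *)
  have [j' [le_j' Aj']] := infA (maxn j.+1 (maxn (pickle w) (size q))).
  have lt_j : (j < j')%N by lia.
  have offF i : (i < a j')%N -> off i -> Z i \in F ++ seg Z (b j).+1 (a j').
    move=> lt_i oi; rewrite mem_cat; have [lt_ij|le_ji] := ltnP i (a j); first by rewrite hF.
    rewrite memseg ?orbT // lt_i andbT ltnNge; apply/negP => le_ib.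
    by apply: oi; exists j; split=> //; rewrite le_ji.
  exists (j', (K', (nx (K', c, v, F)).1, rcons v w, F ++ seg Z (b j).+1 (a j'))) => _ _ /=.
  split=> //; split=> //.
  - split=> //; apply: occurs_extend => //; lia.
  - split=> //; right; case: hc lc => [->//|h1 h2]; exact: (omega_times_trans ltr) h1.
  - apply: hlose => [g /mapP[i]|].
      rewrite mem_iota => /andP[le_i _] ->; apply: sp_gen; apply: leq_trans (ltnW le_i).
      exact: occurs_bound.
    apply: span_mem => i lt_i nq; apply: offF.
      by apply: leq_trans lt_i _; apply: leq_trans (left_end_ge Z nx j'); lia.
    apply: contrapT => noff; move/eqP: nq; apply; apply: q2; exact: hd.
  - rewrite !size_rcons sv; split=> // i; rewrite !nth_rcons sv ltnS leq_eqVlt => /predU1P[->|lt_i].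
      rewrite ltnn eqxx /w ev_sub distrC.
      rewrite -(subrK (comb N d (fun i => ev e (Z i))) x) -addrA.
      apply: le_trans (ler_normD _ _) _.
      move: xd; rewrite -/(comb N d _) => xd; lra.
    by rewrite lt_i; exact: hv.
have [stp hstp] := choice step.
(* Stage [j0] considers starting positions with constants up to [j0], so [Kn] is among them. *)
have [j0 [le_j0 Aj0]] := infA Kn.
pose st0 : nat * position := (j0, (Kn, (al, 0%N), [::], seg Z 0 (a j0))).
pose run := foldl (fun (q : seq W * (nat * position)) x => (rcons q.1 x, stp (q, x))) ([::], st0).
have I0 : Inv [::] st0.
  split=> //.
  - by split=> //; exact: occurs_init.
  - by split=> //; left.
  - by move=> i lt_i _; exact: memseg.
have runE s : (run s).1 = s.
  by elim/last_ind: s => // s x IH; rewrite /run -cats1 foldl_cat /= -/(run s) IH cats1.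
have runS s x : (run (rcons s x)).2 = stp (s, (run s).2, x).
  rewrite /run -cats1 foldl_cat /= -/(run s); case: (run s) (runE s) => /= s' t -> //.
have runI s : T s -> Inv s (run s).2.
  elim/last_ind: s => // s x IH Tx; have [Ts _] := emb_tree_prefix K0 Tx.
  by rewrite runS; have := hstp (s, (run s).2, x) (IH Ts) Tx; case.
(* The next answer of I, not the current clock: it is below [(al, 0)] already at the root. *)
pose f s := (nx (run s).2.2).1.
have fc s : T s -> olt (f s) (run s).2.2.1.1.2 /\ olt (f s) (al, 0%N).
  move=> Ts; have := runI s Ts; rewrite /f; case: (run s).2 => j [[[K' c] v] F] I1 /=.
  have Q := invEqv _ _ _ _ _ _ Ts I1; have [_ [_ hc] nWp _ _] := I1.
  have [lc _] := hnx (K', c, v, F) nWp Q; split=> //.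
  by case: hc lc => [->//|h1 h2]; exact: (omega_times_trans ltr) h1.
have fS s x : T (rcons s x) -> olt (f (rcons s x)) (f s).
  move=> Tx; have [Ts _] := emb_tree_prefix K0 Tx.
  have [_ _ ec] := hstp (s, (run s).2, x) (runI s Ts) Tx.
  by have [h _] := fc _ Tx; move: h; rewrite runS ec.
have Tnil : T [::].
  by split=> // c; rewrite /= !big_ord0 normr0 !mulr0 lexx.
have fal s : T s -> lt (f s).1 al by move=> /fc[_ [//|[_]]].
(* A value for sequences off the tree; the empty node provides one. *)
pose dflt : {o | lt o al} := exist _ _ (fal _ Tnil).
pose g s : {o | lt o al} * nat :=
  (if pselect (lt (f s).1 al) is left h then exist _ _ h else dflt, (f s).2).
have gE s : T s -> sval (g s).1 = (f s).1.
  by move=> Ts; rewrite /g /=; case: pselect => // h; case: h; exact: (fal _ Ts).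
exists g; split=> // s t Ts Tt [lt_st est].
have [u et] : exists u, t = s ++ u by exists (drop (size s) t); rewrite [s in s ++ _]est cat_take_drop.
have : olt (f t) (f s).
  have nu : u != [::] by apply/eqP => u0; move: lt_st; rewrite et u0 cats0 ltnn.
  rewrite et in Tt *; elim/last_ind: u nu Tt {et} => // u x IH _ Tt.
  rewrite -rcons_cat in Tt *; have h1 := fS _ _ Tt.
  have [u0|nu] := eqVneq u [::]; first by rewrite u0 cats0 in h1 *.
  have [Tu _] := emb_tree_prefix K0 Tt.
  exact: (omega_times_trans ltr) h1 (IH nu Tu).
move=> [h|[h1 h2]]; [left|right]; rewrite /= ?gE //.
split=> //; have eqsub (p q : {o | lt o al}) : sval p = sval q -> p = q.
  by case: p q => [p hp] [q hq] /= pq; apply: eq_exist.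
by apply: eqsub; rewrite !gE // h1.
Qed.

End Tight.

Lemma schauder_basic (R : realType) (W : completeNormedModType R) (e : nat -> W)
  (cf : W -> nat -> R) (C : R) :
  (forall x n, `|comb n (cf x) e| <= C * `|x|) ->
  (forall n c i, cf (comb n c e) i = if (i < n)%N then c i else 0) -> basic C e.
Proof.
move=> cfB cfE; split=> [i|n m c le_nm].
  apply/negP => /eqP ei0; have := cfE i.+1 (fun j => (j == i)%:R) i.
  rewrite ltnSn eqxx /comb big_ord_recr /= ei0 scaler0 big1 => [|j _]; last first.
    by rewrite ltn_eqF // scale0r.
  have := cfE 0%N (fun=> 0) i; rewrite /comb big_ord0 add0r => -> /eqP.
  by rewrite eq_sym oner_eq0.
have := cfB (comb m c e) n; rewrite (@eq_comb _ _ n _ c e e) // => i lt_i.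
by rewrite cfE (leq_trans lt_i).
Qed.

(** * The two alternatives *)

Section Dichotomy.
Variables (R : realType) (W : completeNormedModType R) (e : nat -> W)
  (cf : W -> nat -> R) (C : R).
Hypotheses (be : basic C e)
  (cfL : forall a x y i, cf (a *: x + y) i = a * cf x i + cf y i)
  (cfB : forall x n, `|comb n (cf x) e| <= C * `|x|)
  (cfE : forall n c i, cf (comb n c e) i = if (i < n)%N then c i else 0).

Definition II_wins (O : Type) (lt : O -> O -> Prop) al Z :=
  exists y K, [/\ bs y, les y Z & WF e (omega_times lt) y (sp Z) K (al, 0%N) [::] [::]].

(** With [les Z y] rather than [les y Z] the property is hereditary in [Z], as fusion requires. *)
Definition uniform (O : Type) (lt : O -> O -> Prop) al Z := exists y K,
  [/\ bs y, les Z y & forall N z, bs N -> les N y ->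
    (forall i, sp y 0 (z i)) -> WT e lt z (sp N 0) K al [::]].

Lemma minimal_of_II_wins (O : Type) (lt : O -> O -> Prop) :
  well_order lt -> (forall a, countable_type {b | lt b a}) -> ~ countable_type O ->
  (forall al Z, bs Z -> II_wins lt al Z) -> exists Y : set W, minimal_subspace Y.
Proof.
move=> wo seg unc P.
have bX : bs (fun i => 'X^i).
  move=> n; split=> [|i]; first by rewrite monic_neq0 // monicXn.
  by rewrite size_polyXn coefXn => lt_i; rewrite ltn_eqF.
have [|y [K [by_ _ hy]]] := @WF_dense_uniform _ _ e unit (fun _ _ => True) tt _ bX.
  move=> Z bZ _; have [y [K [by_ ly hy]]] := WF_all_clocks wo seg unc bZ (fun al => P al Z bZ).
  exists y, K; split=> //.
  (* Under an always true relation every clock maps to the one-point clock, so no spare rounds need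
     be counted. *)
  by apply: (@WF_clock _ _ e _ _ _ (omega_times (fun _ _ : unit => True)) (fun=> tt) y _ K (tt, 0%N)) hy.
exists (cspan (fun i => ev e (y i)) setT).
apply: (minimal_of_branches be cfL cfB cfE by_) => N bN lN.
by apply: hy => // i; apply: sp_gen.
Qed.

(** Stabilization needs countably many positions, so the clock is copied to [nat] along an injection
    and the result is copied back. *)
Lemma uniform_of_II_wins (O : Type) (lt : O -> O -> Prop) al (o : {b | lt b al}) Z :
  countable_type {b | lt b al} -> bs Z ->
  (forall Z, bs Z -> II_wins lt (sval o) Z) ->
  exists Z', [/\ bs Z', les Z' Z &
    uniform (fun x y : {b | lt b al} => lt (sval x) (sval y)) o Z'].
Proof.
move=> [f injf] bZ P; pose O' := {b | lt b al}.
have H n : exists o' : O', forall o'', f o'' = n -> o' = o''.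
  have [[c' ec']|h] := pselect (exists o', f o' = n).
    by exists c' => o'' eo''; apply: injf; rewrite ec' eo''.
  by exists o => o'' e'; case: h; exists o''.
have [g hg] := choice H; have fK o' : g (f o') = o' by apply: hg.
pose lt' n m := lt (sval (g n)) (sval (g m)).
have [|y [K [by_ ly hy]]] := @WF_dense_uniform _ _ e nat lt' (f o) _ bZ.
  move=> Z' bZ' _; have [y [K [by_ ly hy]]] := P Z' bZ'; exists y, K; split=> //.
  apply: (@WF_clock _ _ e _ _ (omega_times lt) _ (fun p => (sval (g p.1), p.2)) y _ K (f o, 0%N)).
    by move=> p q [h|[h1 h2]]; [left|right; rewrite /= h1].
  by rewrite fK.
exists y; split=> //; exists y, K; split=> //; first exact: les_refl.
move=> N z bN lN hz.
by apply: (@WT_clock _ _ e _ _ lt' _ f z _ K o) (hy N z bN lN hz) => c d; rewrite /lt' !fK.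
Qed.

Lemma uniform_all (O : Type) (lt : O -> O -> Prop) al Z :
  countable_type {b | lt b al} -> bs Z ->
  (forall o, lt o al -> forall Z, bs Z -> II_wins lt o Z) ->
  exists Z', [/\ bs Z', les Z' Z & forall o,
    uniform (fun x y : {b | lt b al} => lt (sval x) (sval y)) o Z'].
Proof.
move=> cO bZ P; have [f injf] := cO; pose O' := {b | lt b al}.
pose D n Z' := forall o : O', f o = n -> uniform (fun x y : O' => lt (sval x) (sval y)) o Z'.
have [||Z' [bZ' lZ' hZ']] := @fusion D Z _ _ bZ.
- move=> n y z by_ ly h o /h [y' [K [h1 h2 h3]]]; exists y', K; split=> //.
  exact: les_trans h2.
- move=> n z bz _; have [[c fc]|h] := pselect (exists o, f o = n); last first.
    by exists z; split=> //; [exact: les_refl|move=> c fc; case: h; exists c].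
  have [z' [bz' lz' hz']] := uniform_of_II_wins (o := c) cO bz (P _ (svalP c)).
  by exists z'; split=> // c' fc'; have -> : c' = c by apply: injf; rewrite fc fc'.
by exists Z'; split=> // o; exact: hZ'.
Qed.

Lemma minimal_of_uniform (O : Type) (lt : O -> O -> Prop) Z :
  well_founded lt -> bs Z -> (forall o, uniform lt o Z) ->
  beta_minimal (fun i => ev e (Z i)) lt.
Proof.
move=> wf bZ U z bz Y [YZ [hY [_ iY]]] o.
have C1 := basic_ge1 be; have beZ := bs_basic be bZ.
have bY : basic C z.
  have [p [g bl]] := block_basis_blocks bz; apply: (blocks_basic beZ bl) => i.
  by have [p' [c [_ /(_ i)[]]]] := bz.
have [|z' [bz' Zz' zz']] := approx_block (eta := fun i => (4 * C)^-1 * 2^-1 ^+ i.+1 * `|z i|) bZ bz.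
  by move=> i; rewrite !mulr_gt0 ?exprn_gt0 ?invr_gt0 ?normr_gt0 ?(proj1 bY) //; lra.
have zeq n : eqv 2 n (fun i => ev e (z' i)) z.
  by apply: (eqv_perturb bY) => i _; exact: zz'.
have [N [u [bN NZ uY uN]]] := approx_subspace be cfL cfB cfE bZ hY iY YZ.
have [y [K [by_ ly hy]]] := U o; have [m hm] := ly 0%N.
have lN : les N Z by move=> n; exists n; apply: sp_min => i le_ni; exact: sp_mono le_ni _ (NZ i).
(* [Z] lies below [y] only from index [m] on; [WT_tail] restores the first [m] terms. *)
have h : WT e lt (fun i => z' (m + i)%N) (sp (fun i => N (m + i)%N) 0) K o [::].
  apply: hy; first exact: bs_tail.
    exact: les_trans (les_tail N m) (les_trans lN ly).
  by move=> i; apply: hm; apply: sp_mono (Zz' _); exact: leq_addr.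
have [K' [K'0 h']] := WT_tail be bz' bN h.
have K'1 : 1 <= K'%:R :> R by rewrite ler1n.
exists (2 * K'%:R * 2); split; first lra.
apply: (WT_not_rank_le wf K'0 hY uY uN zeq _ h').
by move=> w /mapP[i _ ->]; apply: sp_gen.
Qed.

End Dichotomy.
Theorem theorem1p3 (R : realType) (W : completeNormedModType R) (e : nat -> W) :
  schauder_basis e ->
  (exists V : set W, minimal_subspace V) \/
  (exists x : nat -> W, block_basis x e /\
     exists (O : Type) (lt : O -> O -> Prop),
       well_order lt /\ countable_type O /\
       beta_minimal x lt /\ beta_tight x (omega_times lt)).
Proof.
move=> /schauder_projections [cf [C [C1 cfL cfB cfE]]].
have be := schauder_basic cfB cfE.
have [T [lt [wo seg unc]]] := first_uncountable.
have [P|nP] := pselect (forall al Z, bs Z -> II_wins e lt al Z).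
  by left; exact: (minimal_of_II_wins be cfL cfB cfE wo seg unc P).
right; have [wf [ltr _]] := wo.
have [al [nal Pal]] : exists al, ~ (forall Z, bs Z -> II_wins e lt al Z) /\
    forall o, lt o al -> forall Z, bs Z -> II_wins e lt o Z.
  apply: contrapT => h; apply: nP => al; elim/(well_founded_ind wf): al => al IH.
  by apply: contrapT => nal; apply: h; exists al.
have /existsNP[Z /not_implyP[bZ nZ]] := nal.
have [Z' [bZ' lZ' uZ']] := uniform_all (seg al) bZ Pal.
exists (fun i => ev e (Z' i)); split; first exact: bs_block_basis be bZ'.
exists {o | lt o al}, (fun a b => lt (sval a) (sval b)).
have wo' := well_order_seg al wo.
split=> //; split; first exact: seg.
split; first exact: (minimal_of_uniform be cfL cfB cfE (proj1 wo') bZ' uZ').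
(* Classical equality on the clock is what lets positions be tested for membership in lists. *)
apply: (@tight_of_not_WF _ _ e C be {classic T} lt al ltr Z' bZ').
move=> y K by_ ly h; apply: nZ; exists y, K; split=> //; first exact: les_trans lZ'.
exact: WF_les lZ' h.
Qed.
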